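(* There exist positive absolute constants $\kappa_3$ and $\kappa_4$ such that, for every convex body $C\subset\mathbb{R}^2$, for every angle $\theta\in\mathbb{T}_{2\pi}$ and for every value $\rho\geq\kappa_3 L_C^{6}/S_C^{7}$, it holds $$\kappa_4\,\rho^{-2}\gamma_C^2(\theta,\rho^{-1})\leq\int_0^1\left|\widehat{\mathbf{1}}_{[\delta]C}(\rho\,\mathbf{u}(\theta))\right|^2 d\delta\leq 2\rho^{-2}\gamma_C^2(\theta,\rho^{-1}).$$
   Context: $\mathbb{T}_{2\pi}=\mathbb{R}/2\pi\mathbb{Z}$; $\mathbf{u}(\theta)=(\cos\theta,\sin\theta)$. A convex body is a bounded convex subset of $\mathbb{R}^2$ with non-empty interior. For $\delta\ge0$, $[\delta]C=\delta C$. The Fourier transform of the indicator function of a bounded measurable $\Omega\subset\mathbb{R}^2$ is $\widehat{\mathbf{1}}_\Omega(\boldsymbol{\xi})=\int_\Omega e^{-2\pi i\mathbf{x}\cdot\boldsymbol{\xi}}\,d\mathbf{x}$. For $\theta\in\mathbb{T}_{2\pi}$ and $\lambda\ge0$, the chord of $C$ in direction $\mathbf{u}(\theta)$ at distance $\lambda$ is $$K_C(\theta,\lambda)=\Big\{\mathbf{x}\in C:\ \mathbf{x}\cdot\mathbf{u}(\theta)=\inf_{\mathbf{y}\in C}(\mathbf{y}\cdot\mathbf{u}(\theta))+\lambda\Big\},$$ $|K_C(\theta,\lambda)|$ is its length, and $\gamma_C(\theta,\lambda)=\max\{|K_C(\theta,\lambda)|,|K_C(\theta+\pi,\lambda)|\}$.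 The longest directional diameter is $L_C=\sup_{\mathbf{x},\mathbf{y}\in C}|\mathbf{x}-\mathbf{y}|$, and the shortest directional diameter is $S_C=\inf_{\theta\in\mathbb{T}_{2\pi}}\sup_{\lambda\ge0}|K_C(\theta,\lambda)|$. *)

(* Defs.v *)
From HB Require Import structures.
From mathcomp Require Import all_boot all_order all_algebra.
From mathcomp Require Import complex.
From mathcomp Require Import all_classical all_reals all_analysis.

Set Implicit Arguments.
Unset Strict Implicit.
Unset Printing Implicit Defensive.

Import Order.TTheory GRing.Theory Num.Theory.
Import numFieldNormedType.Exports.

Local Open Scope classical_set_scope.
Local Open Scope ring_scope.

Section plane.
Context {R : realType}.

Definition dot (x y : R * R) : R := x.1 * y.1 + x.2 * y.2.

(* The norm that the library puts on [R * R] is the sup norm. *)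
Definition eucl_norm (x : R * R) : R := Num.sqrt (dot x x).

(* Angles are real numbers: everything below depends on [theta] only through
   [cos theta] and [sin theta], hence only on its class modulo [2 * pi]. *)
Definition unit_vec (theta : R) : R * R := (cos theta, sin theta).

Definition convex_body (C : set (R * R)) : Prop :=
  [/\ bounded_set C, convex_set C & C° !=set0].

Definition dilate (delta : R) (C : set (R * R)) : set (R * R) :=
  [set delta *: x | x in C].

Local Notation lebesgue2 := (@lebesgue_measure R \x @lebesgue_measure R)%E.

Definition expi (t : R) : R[i] := Complex (cos t) (sin t).

Definition integral2C (A : set (R * R)) (f : R * R -> R[i]) : R[i] :=
  Complex (Rintegral lebesgue2 A (fun x => complex.Re (f x)))
          (Rintegral lebesgue2 A (fun x => complex.Im (f x))).

(* A convex body need not be Borel (part of its boundary may be missing).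
   The library integral of a non-measurable nonnegative function is the
   supremum of the integrals of the simple functions below it; since the
   boundary of a convex body is a null set, on such a set it is the usual
   Lebesgue integral. *)
Definition fourier_indicator (Omega : set (R * R)) (xi : R * R) : R[i] :=
  integral2C Omega (fun x => expi (- (2 * pi * dot x xi))).

Definition chord (C : set (R * R)) (theta lambda : R) : set (R * R) :=
  [set x | C x /\
    dot x (unit_vec theta) =
      inf [set dot y (unit_vec theta) | y in C] + lambda].

(* The length of a chord is the one-dimensional measure of the chord read in
   the arc-length coordinate [x . u(theta + pi / 2)] of the line that
   carries it. *)
Definition chord_length (C : set (R * R)) (theta lambda : R) : R :=
  fine (lebesgue_measure
    [set dot x (unit_vec (theta + pi / 2)) | x in chord C theta lambda]).

Definition max_chord_length (C : set (R * R)) (theta lambda : R) : R :=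
  Num.max (chord_length C theta lambda) (chord_length C (theta + pi) lambda).

Definition longest_diameter (C : set (R * R)) : R :=
  sup [set eucl_norm (x - y) | x in C & y in C].

Definition shortest_diameter (C : set (R * R)) : R :=
  inf [set sup [set chord_length C theta lambda | lambda in `[0, +oo[]
      | theta in [set: R]].

End plane.

(* Main.v *)
(* In the orthonormal frame attached to [theta], let [f p] be the length of the
   chord of [C] at abscissa [p]: it is nonnegative and concave on an interval
   [(a, b)], and the transform of [delta C] at [rho u(theta)] is
   [delta ^ 2 * fhat (rho delta)]. Since [shortest <= b - a <= longest], the
   hypothesis on [rho] only serves to give [11 / rho <= b - a].
   Upper bound: shifting by the half-period [h] of the exponential bounds
   [4 |fhat|] by the integral of twice the positive part of the second
   difference of [f] at step [h]. By concavity that part lives within [h] of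
   [a] and [b], where [f] is controlled by [f (a + 1 / rho)] and
   [f (b - 1 / rho)]; the bound holds for each [delta] separately.
   Lower bound, by duality: [fhat] is tested against a function of [delta],
   bounded by [delta ^ 2] on [0, 1], whose cosine transform is positive on
   [[8, oo)]. Placing the larger of the two end chords next to the origin of
   that half-line leaves no cancellation in the pairing with [f >= 0]. *)

Require Import Defs.
From HB Require Import structures.
From mathcomp Require Import all_boot all_order all_algebra.
From mathcomp Require Import complex.
From mathcomp Require Import all_classical all_reals all_analysis.
From mathcomp Require Import measurable_realfun.
From mathcomp Require Import ring lra.

Set Implicit Arguments.
Unset Strict Implicit.
Unset Printing Implicit Defensive.

Import Order.TTheory GRing.Theory Num.Theory.
Import numFieldNormedType.Exports.

Local Open Scope classical_set_scope.
Local Open Scope ring_scope.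


(** No lower bound can hold for each [delta] separately, since the transform may vanish at some of
    them; the average is essential there. Translating [f] does not change the modulus of its
    transform, so [f] may be tested with the phase [d * (A + B * x)] for any constant [A]: this is
    the freedom that puts either end of the interval at phase 8. In the upper bound, the half-period
    at frequency [2 * pi * d / s] is [s / (2 * d)], and over twice that length concavity lets [f]
    grow by a factor of order [1 / d]. *)

Section bounded_finite_support.
Context d (T : measurableType d) (R : realType).
Variable mu : {measure set T -> \bar R}.

(* Finite support in the sense of measure, together with boundedness: a class
   of integrable functions stable under shifts, tensor products and products
   with bounded functions. *)
Definition finsupp (f : T -> R) :=
  measurable_fun [set: T] f /\ exists M B,
    [/\ measurable B, (mu B < +oo)%E, forall x, `|f x| <= M
      & forall x, ~ B x -> f x = 0].

Lemma finsupp_integrable f : finsupp f -> mu.-integrable [set: T] (EFin \o f).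
Proof.
move=> [mf [M [B [mB fB fM f0]]]].
have -> : EFin \o f = (EFin \o f) \_ B.
  apply/funext => x; rewrite patchE; case: ifPn => // /negP.
  by rewrite inE /= => /f0 ->.
apply: ((integrable_mkcond (EFin \o f) mB).1); apply: (@measurable_bounded_integrable _ _ _ _ f) => //.
  exact: measurable_funTS.
exists M; split; first exact: num_real.
by move=> N MN x _; exact: le_trans (fM x) (ltW MN).
Qed.

Lemma finsuppM (f g : T -> R) : finsupp f -> measurable_fun [set: T] g ->
  (exists K, forall x, `|g x| <= K) -> finsupp (fun x => f x * g x).
Proof.
move=> [mf [M [B [mB fB fM f0]]]] mg [K gK]; split.
  exact: measurable_funM.
exists (M * K), B; split=> // x; last by move/f0 => ->; rewrite mul0r.
by rewrite normrM ler_pM.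
Qed.

Lemma finsuppD (f g : T -> R) : finsupp f -> finsupp g -> finsupp (fun x => f x + g x).
Proof.
move=> [mf [M [B [mB fB fM f0]]]] [mg [N [D [mD fD gN g0]]]]; split.
  exact: measurable_funD.
exists (M + N), (B `|` D); split=> [| |x|x].
- exact: measurableU.
- by rewrite (le_lt_trans (measureU2 _ _ _))// lte_add_pinfty.
- by rewrite (le_trans (ler_normD _ _))// lerD.
- by move=> /not_orP[/f0 -> /g0 ->]; rewrite addr0.
Qed.

Lemma finsuppZ (k : R) (f : T -> R) : finsupp f -> finsupp (fun x => k * f x).
Proof.
move=> hf; have -> : (fun x => k * f x) = (fun x => f x * cst k x).
  by apply/funext => x; rewrite mulrC.
by apply: finsuppM => //; exists `|k|.
Qed.

Lemma finsuppB (f g : T -> R) : finsupp f -> finsupp g -> finsupp (fun x => f x - g x).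
Proof.
move=> hf hg; have -> : (fun x => f x - g x) = (fun x => f x + -1 * g x).
  by apply/funext => x; rewrite mulN1r.
by apply: finsuppD => //; exact: finsuppZ.
Qed.

Lemma finsupp_RintegralD (f g : T -> R) : finsupp f -> finsupp g ->
  \int[mu]_x (f x + g x) = \int[mu]_x f x + \int[mu]_x g x.
Proof. by move=> hf hg; rewrite RintegralD//; exact: finsupp_integrable. Qed.

Lemma finsupp_RintegralB (f g : T -> R) : finsupp f -> finsupp g ->
  \int[mu]_x (f x - g x) = \int[mu]_x f x - \int[mu]_x g x.
Proof. by move=> hf hg; rewrite RintegralB//; exact: finsupp_integrable. Qed.

Lemma finsupp_RintegralZ (k : R) (f : T -> R) : finsupp f ->
  \int[mu]_x (k * f x) = k * \int[mu]_x f x.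
Proof. by move=> hf; rewrite RintegralZl//; exact: finsupp_integrable. Qed.

Lemma finsupp_le_Rintegral (f g : T -> R) : finsupp f -> finsupp g ->
  (forall x, f x <= g x) -> \int[mu]_x f x <= \int[mu]_x g x.
Proof. by move=> hf hg fg; apply: le_Rintegral => //; exact: finsupp_integrable. Qed.

Lemma finsupp_indic (A : set T) : measurable A -> (mu A < +oo)%E ->
  finsupp (\1_A : T -> R).
Proof.
move=> mA fA; split; first exact: measurable_indic.
exists 1, A; split=> // x; last by move=> nA; rewrite indicE memNset.
by rewrite indicE; case: (_ \in _); rewrite ?normr1 ?normr0.
Qed.

Lemma Rintegral_indic (A : set T) : measurable A ->
  \int[mu]_x (\1_A x : R) = fine (mu A).
Proof. by move=> mA; rewrite /Rintegral integral_indic// setIT. Qed.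

End bounded_finite_support.

(** * Affine changes of variable on the line *)

Section affine.
Context {R : realType}.
Notation mu := (@lebesgue_measure R).

Lemma measurable_affine (a b : R) :
  measurable_fun [set: R] (fun y : R => a * y + b).
Proof. by apply: measurable_funD => //; exact: measurable_funM. Qed.

(** Uniqueness of Lebesgue measure: the pushforward multiplied by [|a|] agrees with it on the
    intervals []x, y]]. For [a < 0] the preimage is closed at the other end, with the same
    length. *)
Lemma lebesgue_measure_affine (a b : R) (A : set R) : a != 0 -> measurable A ->
  mu ((fun y => a * y + b) @^-1` A) = ((`|a|^-1)%:E * mu A)%E.
Proof.
move=> a0 mA; pose phi : measurableTypeR R -> measurableTypeR R := fun y => a * y + b.
have mphi : measurable_fun setT phi by exact: measurable_affine.
have na : 0 < `|a| by rewrite normr_gt0.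
have [nu nuE] : exists nu : {measure set (measurableTypeR R) -> \bar R},
    forall B, nu B = (`|a|%:E * mu (phi @^-1` B))%E.
  by unshelve (eexists (mscale (NngNum (ltW na)) (pushforward mu phi))).
have E : mu A = nu A.
  apply: lebesgue_measure_unique => // _ [[x y]] /= _ <-.
  rewrite nuE.
  have [a_gt0|a_le0] := ltP 0 a.
    have -> : phi @^-1` `]x, y] = `](x - b) / a, (y - b) / a]%classic.
      apply/seteqP; split => z; rewrite /phi/= !in_itv /=
        ltr_pdivrMr// ler_pdivlMr// ltrBlDr lerBrDr (mulrC z) => //.
    rewrite gtr0_norm// !lebesgue_measure_itv/= !lte_fin ltr_pM2r ?invr_gt0//.
    rewrite ltrD2r; case: ifPn => // _; last by rewrite mule0.
    by rewrite -!EFinD -EFinM; congr EFin; field.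
  have {a_le0}a_lt0 : a < 0 by rewrite lt_neqAle a0.
  have -> : phi @^-1` `]x, y] = `[(y - b) / a, (x - b) / a[%classic.
    apply/seteqP; split => z; rewrite /phi/= !in_itv /=
        ltr_ndivlMr// ler_ndivrMr// ltrBlDr lerBrDr (mulrC z) andbC => //.
  rewrite ltr0_norm// !lebesgue_measure_itv/= !lte_fin ltr_nM2r ?invr_lt0//.
  rewrite ltrD2r; case: ifPn => // _; last by rewrite mule0.
  by rewrite -!EFinD -EFinM; congr EFin; field.
rewrite E nuE muleA -EFinM mulVf ?mul1e//.
by rewrite gt_eqF.
Qed.

Lemma finsupp_itv (a b : R) : a <= b -> finsupp mu (\1_`[a, b] : R -> R) /\
  \int[mu]_x (\1_`[a, b] x : R) = b - a.
Proof.
move=> ab; have muab : mu `[a, b] = (b - a)%:E.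
  rewrite lebesgue_measure_itv /= lte_fin; case: ltgtP ab => // <-.
  by rewrite subrr.
split; first by apply: finsupp_indic => //; rewrite [ltLHS]muab ltry.
by rewrite Rintegral_indic//= muab.
Qed.

Lemma Rintegral_shift (f : R -> R) (h : R) :
  finsupp mu f -> finsupp mu (fun x => f (x + h)) /\
  \int[mu]_x f (x + h) = \int[mu]_x f x.
Proof.
move=> hf; pose phi : measurableTypeR R -> measurableTypeR R := fun y => 1 * y + h.
have mphi : measurable_fun setT phi by exact: measurable_affine.
have phiE x : phi x = x + h by rewrite /phi mul1r.
have [mf [M [B [mB fB fM f0]]]] := hf.
have hfh : finsupp mu (fun x => f (x + h)).
  split.
    have -> : (fun x => f (x + h)) = f \o phi by apply/funext => x /=; rewrite phiE.
    exact: measurableT_comp.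
  exists M, (phi @^-1` B); split => //.
  - by rewrite -[X in measurable X]setTI; exact: mphi.
  - rewrite [ltLHS]lebesgue_measure_affine// ?oner_neq0//.
    by rewrite normr1 invr1 mul1e.
  - by move=> x; rewrite /= phiE => /f0.
split=> //; rewrite /Rintegral; congr fine.
transitivity (\int[pushforward mu phi]_x (EFin \o f) x)%E; last first.
  apply: eq_measure_integral => A mA _.
  by rewrite [LHS]lebesgue_measure_affine// ?oner_neq0// normr1 invr1 mul1e.
rewrite (@integral_pushforward _ _ _ _ _ phi)//; last 2 first.
- exact/measurable_EFinP.
- rewrite preimage_setT; have := finsupp_integrable hfh.
  by congr (integrable _ _ _); apply/funext => x; rewrite /= phiE.
by rewrite preimage_setT; apply: eq_integral => x _; rewrite /= phiE.
Qed.

End affine.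

(** * Transforms of concave functions: upper bound *)

Section concave.
Context {R : realType}.
Notation mu := (@lebesgue_measure R).

Definition concave_itv (f : R -> R) (a b : R) := forall x z y,
  a < x -> x < z -> z < y -> y < b ->
  (y - z) * f x + (z - x) * f y <= (y - x) * f z.

(* The chords of the graph are drawn through [a + s / 10] and [a + 10 * s] rather
   than through the endpoints, where [f] need not be concave; this costs the
   factors [10 / 9] and [8 / 9]. *)
Section growth.
Variables (f : R -> R) (a b s : R).
Hypotheses (cf : concave_itv f a b) (f0 : forall x, 0 <= f x).
Hypotheses (s0 : 0 < s) (sab : a + 10 * s < b).

Lemma concave_le_near x : a < x -> x <= a + s -> f x <= 10 / 9 * f (a + s).
Proof.
have [s0' sab'] := (s0, sab).
move=> ax; rewrite le_eqVlt => /predU1P[->|xs]; first by have := f0 (a + s); lra.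
have H : (a + 10 * s - (a + s)) * f x + (a + s - x) * f (a + 10 * s) <=
    (a + 10 * s - x) * f (a + s) by apply: cf => //; lra.
have [h1 h2] := (f0 (a + 10 * s), f0 (a + s)).
have H1 : 0 <= (a + s - x) * f (a + 10 * s) by rewrite mulr_ge0//; lra.
have H2 : 0 <= (x - a) * f (a + s) by rewrite mulr_ge0//; lra.
suff : s * f x <= s * (10 / 9 * f (a + s)) by rewrite ler_pM2l.
lra.
Qed.

Lemma concave_le_far x : a + s <= x -> x < b ->
  f x <= 10 / 9 * ((x - a) / s) * f (a + s).
Proof.
have [s0' sab'] := (s0, sab).
move=> + xb; rewrite le_eqVlt => /predU1P[<-|xs].
  by rewrite addrAC subrr add0r divff ?gt_eqF// mulr1; have := f0 (a + s); lra.
have h1 : a < a + s / 10 by lra.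
have h2 : a + s / 10 < a + s by lra.
have H : (x - (a + s)) * f (a + s / 10) + (a + s - (a + s / 10)) * f x <=
    (x - (a + s / 10)) * f (a + s) by exact: cf.
have H1 : 0 <= (x - (a + s)) * f (a + s / 10) by rewrite mulr_ge0//; lra.
have H2 : 0 <= s * f (a + s) by rewrite mulr_ge0// ltW.
suff : s * f x <= s * (10 / 9 * ((x - a) / s) * f (a + s)) by rewrite ler_pM2l.
have -> : s * (10 / 9 * ((x - a) / s) * f (a + s)) =
  10 / 9 * (x - a) * f (a + s) by field; rewrite gt_eqF.
lra.
Qed.

(** Concavity allows at most linear growth away from [a], hence a loss of [1 / d] at distance
    [s / d]. That distance is twice the half-period in [weighted_power_le]. *)
Lemma concave_le d x : 0 < d -> d <= 1 -> a < x -> x < b -> x <= a + s / d ->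
  f x <= 10 / 9 * f (a + s) / d.
Proof.
have [s0' sab'] := (s0, sab).
move=> d0 d1 ax xb xd; rewrite ler_pdivlMr//.
have [fx fs] := (f0 x, f0 (a + s)).
have [xs|sx] := leP x (a + s).
  have := concave_le_near ax xs; nra.
have := concave_le_far (ltW sx) xb => H.
have xds : (x - a) / s * d <= 1.
  by rewrite mulrAC ler_pdivrMr// mul1r -ler_pdivlMr// lerBlDl.
apply: (le_trans (ler_wpM2r (ltW d0) H)).
have -> : 10 / 9 * ((x - a) / s) * f (a + s) * d =
  (10 / 9 * f (a + s)) * ((x - a) / s * d) by ring.
by apply: ler_piMr => //; rewrite mulr_ge0//; lra.
Qed.

(** The chord from [a + s] to [a + 10 * s], where [f] is at least 0, loses at most a ninth of its
    initial height over the first length [s]. This window is the one tested in the lower bound. *)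
Lemma concave_ge x : a + s <= x -> x <= a + 2 * s -> 8 / 9 * f (a + s) <= f x.
Proof.
have [s0' sab'] := (s0, sab).
rewrite le_eqVlt => /predU1P[<-|sx] xs; first by have := f0 (a + s); lra.
have H : (a + 10 * s - x) * f (a + s) + (x - (a + s)) * f (a + 10 * s) <=
    (a + 10 * s - (a + s)) * f x by apply: cf => //; lra.
have [h1 h2] := (f0 (a + 10 * s), f0 (a + s)).
have H1 : 0 <= (x - (a + s)) * f (a + 10 * s) by rewrite mulr_ge0//; lra.
have H2 : 0 <= (a + 2 * s - x) * f (a + s) by rewrite mulr_ge0//; lra.
suff : s * (8 / 9 * f (a + s)) <= s * f x by rewrite ler_pM2l.
lra.
Qed.

End growth.

Lemma measurable_cos_affine (A B : R) :
  measurable_fun [set: R] (fun x => cos (A * x + B)).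
Proof.
apply: measurableT_comp; last exact: measurable_affine.
by apply: continuous_measurable_fun; exact: continuous_cos.
Qed.

Lemma measurable_sin_affine (A B : R) :
  measurable_fun [set: R] (fun x => sin (A * x + B)).
Proof.
apply: measurableT_comp; last exact: measurable_affine.
by apply: continuous_measurable_fun; exact: continuous_sin.
Qed.

Lemma measurable_cosM (A : R) : measurable_fun [set: R] (fun x => cos (A * x)).
Proof.
by under eq_fun do rewrite -[A * _]addr0; exact: measurable_cos_affine.
Qed.

Lemma measurable_sinM (A : R) : measurable_fun [set: R] (fun x => sin (A * x)).
Proof.
by under eq_fun do rewrite -[A * _]addr0; exact: measurable_sin_affine.
Qed.

Lemma normr_cos_le1 (x : R) : `|cos x| <= 1.
Proof. by rewrite ler_norml cos_geN1 cos_le1. Qed.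

Lemma normr_sin_le1 (x : R) : `|sin x| <= 1.
Proof. by rewrite ler_norml sin_geN1 sin_le1. Qed.

Definition cos_transform (f : R -> R) (t : R) : R :=
  \int[mu]_x (f x * cos (t * x)).

Definition sin_transform (f : R -> R) (t : R) : R :=
  \int[mu]_x (f x * sin (t * x)).

Section upper.
Variables (f : R -> R) (a b h K : R).
Hypotheses (hf : finsupp mu f) (cf : concave_itv f a b) (f0 : forall x, 0 <= f x).
Hypotheses (supp : forall x, ~ (a < x < b) -> f x = 0) (h0 : 0 < h) (K0 : 0 <= K).
Hypotheses (fa : forall x, a < x -> x < b -> x <= a + 2 * h -> f x <= K).
Hypotheses (fb : forall x, a < x -> x < b -> b - 2 * h <= x -> f x <= K).

Let g x := K * (\1_`[a - h, a + h] x + \1_`[b - h, b + h] x).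

(** Within [h] of [a], the term [f (x - h)] vanishes and [f (x + h) <= K]; near [b] the roles are
    exchanged. Between the two windows the second difference is nonpositive by concavity, and beyond
    [a - h] and [b + h] all three values are 0. *)
Let second_difference_le x : f (x + h) + f (x - h) - 2 * f x <= g x.
Proof.
have [h0' K0'] := (h0, K0).
have fx := f0 x.
have fK1 y : y <= a + 2 * h -> f y <= K.
  move=> y2; have [/andP[ay yb]|/negP n] := boolP (a < y < b); first exact: fa.
  by rewrite supp.
have fK2 y : b - 2 * h <= y -> f y <= K.
  move=> y2; have [/andP[ay yb]|/negP n] := boolP (a < y < b); first exact: fb.
  by rewrite supp.
rewrite /g !indicE.
have [|nA] := boolP (x \in `[a - h, a + h]%classic).
  rewrite inE/= in_itv/= => /andP[x1 x2].
  have -> : f (x - h) = 0 by apply: supp => /andP[]; lra.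
  have := fK1 (x + h) ltac:(lra).
  by case: (_ \in _) => /=; lra.
have [|nB] := boolP (x \in `[b - h, b + h]%classic).
  rewrite inE/= in_itv/= => /andP[x1 x2].
  have -> : f (x + h) = 0 by apply: supp => /andP[]; lra.
  by have := fK2 (x - h) ltac:(lra); rewrite /=; lra.
rewrite /= addr0 mulr0.
have {nA} : ~ (a - h <= x <= a + h).
  by move=> H; move/negP: nA; apply; rewrite inE/= in_itv.
have {nB} : ~ (b - h <= x <= b + h).
  by move=> H; move/negP: nB; apply; rewrite inE/= in_itv.
move=> nB nA.
have [x1|x1] := ltP x (a - h).
  by rewrite !supp; [lra|move=> /andP[]; lra..].
have [x2|x2] := ltP (b + h) x.
  by rewrite !supp; [lra|move=> /andP[]; lra..].
have x3 : a + h < x by rewrite ltNge; apply/negP => H; apply: nA; apply/andP.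
have x4 : x < b - h by rewrite ltNge; apply/negP => H; apply: nB; apply/andP.
have := @cf (x - h) x (x + h) ltac:(lra) ltac:(lra) ltac:(lra) ltac:(lra).
have -> : x + h - x = h by ring.
have -> : x - (x - h) = h by ring.
have -> : x + h - (x - h) = h * 2 by ring.
by rewrite -mulrDr -mulrA ler_pM2l//; lra.
Qed.

(* With [r = |fhat|] and [w] the real wave such that [r ^ 2] is the integral of
   [f * w], shifting by [h] changes the sign of [w], so that [4 * r ^ 2] is the
   integral of the second difference of [f] against [r - w >= 0]. *)
Lemma transform_sqr_le :
  cos_transform f (pi / h) ^+ 2 + sin_transform f (pi / h) ^+ 2 <= (2 * h * K) ^+ 2.
Proof.
have [h0' K0'] := (h0, K0).
set t := pi / h; set X := cos_transform f t; set Y := sin_transform f t.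
set r := Num.sqrt (X ^+ 2 + Y ^+ 2).
have r0 : 0 <= r by exact: sqrtr_ge0.
have r2 : r ^+ 2 = X ^+ 2 + Y ^+ 2 by rewrite sqr_sqrtr// addr_ge0// sqr_ge0.
pose w x := X * cos (t * x) + Y * sin (t * x).
have wr x : `|w x| <= r.
  rewrite -(ler_pXn2r (_ : (0 < 2)%N)) ?nnegrE// real_normK ?num_real// r2 /w.
  have := sqr_ge0 (X * sin (t * x) - Y * cos (t * x)).
  have := cos2Dsin2 (t * x); nra.
have th y : t * (y + h) = t * y + pi by rewrite mulrDr /t divfK ?gt_eqF.
have wD x : w (x + h) = - w x by rewrite /w !th cosDpi sinDpi; ring.
have wB x : w (x - h) = - w x by rewrite -{2}(subrK h x) wD opprK.
have mw : measurable_fun setT w.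
  by apply: measurable_funD; apply: measurable_funM => //;
    [exact: measurable_cosM|exact: measurable_sinM].
have hfc : finsupp mu (fun x => f x * cos (t * x)).
  apply: finsuppM => //; first exact: measurable_cosM.
  by exists 1 => x; exact: normr_cos_le1.
have hfs : finsupp mu (fun x => f x * sin (t * x)).
  apply: finsuppM => //; first exact: measurable_sinM.
  by exists 1 => x; exact: normr_sin_le1.
have hfw : finsupp mu (fun x => f x * w x).
  by apply: finsuppM => //; exists r.
have fw : \int[mu]_x (f x * w x) = r ^+ 2.
  rewrite r2 -[X ^+ 2]/(X * X) -[Y ^+ 2]/(Y * Y).
  rewrite {2}/X /cos_transform {2}/Y /sin_transform.
  rewrite -!finsupp_RintegralZ// -finsupp_RintegralD; [|exact: finsuppZ..].
  by apply: eq_Rintegral => x _; rewrite /w; ring.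
(* [P] is [f] times [r + w] and [Q] is [f] times [r - w]. As [w] changes sign under a shift by [h],
   both shifts of [P] carry the factor [r - w] of [Q]. *)
pose P x := r * f x + f x * w x.
pose Q x := r * f x - f x * w x.
have hP : finsupp mu P by apply: finsuppD => //; exact: finsuppZ.
have hQ : finsupp mu Q by apply: finsuppB => //; exact: finsuppZ.
have [hP1 iP1] := Rintegral_shift h hP.
have [hP2 iP2] := Rintegral_shift (- h) hP.
have hg : finsupp mu g.
  by apply: finsuppZ; apply: finsuppD;
    apply: (finsupp_itv _).1; lra.
have ig : \int[mu]_x g x = 4 * h * K.
  rewrite finsupp_RintegralZ ?finsupp_RintegralD; last first.
  - by apply: finsuppD; apply: (finsupp_itv _).1; lra.
  - by apply: (finsupp_itv _).1; lra.
  - by apply: (finsupp_itv _).1; lra.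
  by rewrite !(finsupp_itv _).2; [ring|lra..].
have : \int[mu]_x (P (x + h) + P (x - h) - 2 * Q x) <= \int[mu]_x (2 * r * g x).
  apply: finsupp_le_Rintegral.
  - by apply: finsuppB; [exact: finsuppD|exact: finsuppZ].
  - exact: finsuppZ.
  move=> x; have -> : P (x + h) + P (x - h) - 2 * Q x =
      (f (x + h) + f (x - h) - 2 * f x) * (r - w x).
    by rewrite /P /Q wD wB; ring.
  have := wr x; rewrite ler_norml => /andP[w1 w2].
  have g0 : 0 <= g x by rewrite mulr_ge0// addr_ge0.
  apply: (@le_trans _ _ (g x * (r - w x))); first by rewrite ler_wpM2r// subr_ge0.
  by rewrite mulrC ler_wpM2r//; lra.
rewrite finsupp_RintegralB; [|exact: finsuppD|exact: finsuppZ].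
rewrite finsupp_RintegralD// iP1 iP2 (finsupp_RintegralZ 2 hQ).
rewrite (finsupp_RintegralZ (2 * r) hg) ig.
rewrite finsupp_RintegralD ?finsupp_RintegralB//; [|exact: finsuppZ..].
rewrite (finsupp_RintegralZ r hf) fw => H.
(* The integrals of [r * f] cancel, leaving [4 * r ^ 2 <= 2 * r * (4 * h * K)]. *)
have {}H : r * r <= r * (2 * h * K) by rewrite expr2 in H; nra.
rewrite -r2 expr2.
have [->|/eqP rn0] := eqVneq r 0; first by rewrite mul0r sqr_ge0.
have rp : 0 < r by rewrite lt_neqAle r0 andbT eq_sym; apply/eqP.
by rewrite ler_pM2l// in H; rewrite expr2 ler_pM.
Qed.

End upper.
End concave.

(** * Transforms of concave functions: lower bound *)

Section weight.
Context {R : realType}.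
Notation mu := (@lebesgue_measure R).

(** One step of Horner's scheme: iterated, it differentiates the nested polynomials below without
    expanding them. *)
Lemma is_derive_affineM (f : R -> R) (c df x : R) : is_derive x 1 f df ->
  is_derive x 1 (fun y => c + y * f y) (f x + x * df).
Proof.
move=> hf; have := @is_deriveD _ _ _ (cst c) (id * f) x 1 0 _
  (is_derive_cst c x 1) (is_deriveM (is_derive_id x 1) hf).
by move=> h; apply: is_derive_eq; rewrite add0r addrC /GRing.scale /= mulr1.
Qed.

Lemma is_derive_cosM (w x : R) : is_derive x 1 (fun y => cos (w * y)) (- (w * sin (w * x))).
Proof.
have h : is_derive x (1 : R) (fun y : R => w * y) w.
  have := is_deriveZ w (is_derive_id x (1 : R)).
  by rewrite /GRing.scale /= mulr1.
have := @is_derive1_comp _ cos _ x _ _ (is_derive_cos (w * x)) h.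
by move=> H; apply: is_derive_eq; rewrite mulNr mulrC.
Qed.

Lemma is_derive_sinM (w x : R) : is_derive x 1 (fun y => sin (w * y)) (w * cos (w * x)).
Proof.
have h : is_derive x (1 : R) (fun y : R => w * y) w.
  have := is_deriveZ w (is_derive_id x (1 : R)).
  by rewrite /GRing.scale /= mulr1.
have := @is_derive1_comp _ sin _ x _ _ (is_derive_sin (w * x)) h.
by move=> H; apply: is_derive_eq; rewrite mulrC.
Qed.

(* The even extension of this polynomial has a kink in its third derivative at 0,
   which contributes the positive term [18 / w ^+ 4] to the cosine transform;
   the cube makes the oscillating contribution of the endpoint 1 at most
   [6 / w ^+ 4]. *)
Definition weight (d : R) : R := - (d ^+ 2 * (1 - d) ^+ 3).

Definition weight_transform (w : R) : R :=
  (18 - 6 * cos w) / w ^+ 4 + 48 * sin w / w ^+ 5 - 120 * (1 - cos w) / w ^+ 6.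

(* The primitive comes from integrating by parts until the polynomial is
   exhausted. *)
Lemma is_derive_weight_primitive (w x : R) : w != 0 ->
  is_derive x 1 (fun y =>
    (2 / w ^+ 3 - 72 / w ^+ 5 + y * (- 18 / w ^+ 3 + 120 / w ^+ 5 +
      y * (- 1 / w + 36 / w ^+ 3 + y * (3 / w - 20 / w ^+ 3 +
      y * (- 3 / w + y * (1 / w)))))) * sin (w * y) +
    (- 18 / w ^+ 4 + 120 / w ^+ 6 + y * (- 2 / w ^+ 2 + 72 / w ^+ 4 +
      y * (9 / w ^+ 2 - 60 / w ^+ 4 + y * (- 12 / w ^+ 2 +
      y * (5 / w ^+ 2))))) * cos (w * y))
    (weight x * cos (w * x)).
Proof.
move=> w0.
have hA := is_derive_affineM (2 / w ^+ 3 - 72 / w ^+ 5)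
  (is_derive_affineM (- 18 / w ^+ 3 + 120 / w ^+ 5)
  (is_derive_affineM (- 1 / w + 36 / w ^+ 3)
  (is_derive_affineM (3 / w - 20 / w ^+ 3)
  (is_derive_affineM (- 3 / w) (is_derive_cst (1 / w) x 1))))).
have hB := is_derive_affineM (- 18 / w ^+ 4 + 120 / w ^+ 6)
  (is_derive_affineM (- 2 / w ^+ 2 + 72 / w ^+ 4)
  (is_derive_affineM (9 / w ^+ 2 - 60 / w ^+ 4)
  (is_derive_affineM (- 12 / w ^+ 2) (is_derive_cst (5 / w ^+ 2) x 1)))).
have H := is_deriveD (is_deriveM hA (is_derive_sinM w x))
  (is_deriveM hB (is_derive_cosM w x)).
apply: is_derive_eq; rewrite /GRing.scale /= /weight.
by field.
Qed.

Lemma Rintegral_weight_cos (w : R) : w != 0 ->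
  \int[mu]_(d in `[0, 1]) (weight d * cos (w * d)) = weight_transform w.
Proof.
move=> w0; rewrite /Rintegral.
pose P y := (2 / w ^+ 3 - 72 / w ^+ 5 + y * (- 18 / w ^+ 3 + 120 / w ^+ 5 +
      y * (- 1 / w + 36 / w ^+ 3 + y * (3 / w - 20 / w ^+ 3 +
      y * (- 3 / w + y * (1 / w)))))) * sin (w * y) +
    (- 18 / w ^+ 4 + 120 / w ^+ 6 + y * (- 2 / w ^+ 2 + 72 / w ^+ 4 +
      y * (9 / w ^+ 2 - 60 / w ^+ 4 + y * (- 12 / w ^+ 2 +
      y * (5 / w ^+ 2))))) * cos (w * y).
have dP (x : R) : is_derive x (1 : R) P (weight x * cos (w * x)) by exact: is_derive_weight_primitive.
have cP : continuous P.
  by move=> x; apply/differentiable_continuous/derivable1_diffP; case: (dP x).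
rewrite (@continuous_FTC2 _ _ P)//.
- rewrite -EFinB /= /P /weight_transform !(mulr0, mul0r, addr0, mulr1, cos0, sin0, mul1r).
  by field.
- apply: continuous_subspaceT => x.
  (* Horner coefficients of [- d ^ 2 + 3 * d ^ 3 - 3 * d ^ 4 + d ^ 5], which is [weight];
     differentiability yields the continuity asked by the fundamental theorem of calculus. *)
  have dw := is_derive_affineM 0 (is_derive_affineM 0 (is_derive_affineM (- 1)
    (is_derive_affineM 3 (is_derive_affineM (- 3) (is_derive_cst (1 : R) (x : R) (1 : R)))))).
  have [/derivable1_diffP /differentiable_continuous + _] :=
    is_deriveM dw (is_derive_cosM w x).
  set g := (X in {for _, continuous X} -> _).
  suff -> : (fun d : R => weight d * cos (w * d)) = g by [].
  by apply/funext => y; rewrite /g /weight !fctE; ring.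
- split.
  + by move=> x _; case: (dP x).
  + by apply: cvg_at_right_filter; exact: cP.
  + by apply: cvg_at_left_filter; exact: cP.
- by move=> x _; rewrite derive1E (derive_val (is_derive := dP x)).
Qed.

(** Worst case of each oscillating factor: [cos w <= 1] leaves 12 out of 18, while [sin w >= -1] and
    [1 - cos w <= 2] produce the lower-order losses. *)
Lemma weight_transform_ge (w : R) : 0 < w ->
  (12 * w ^+ 2 - 48 * w - 240) / w ^+ 6 <= weight_transform w.
Proof.
move=> w0; rewrite ler_pdivrMr ?exprn_gt0// /weight_transform.
have -> : ((18 - 6 * cos w) / w ^+ 4 + 48 * sin w / w ^+ 5 -
    120 * (1 - cos w) / w ^+ 6) * w ^+ 6 =
  (18 - 6 * cos w) * w ^+ 2 + 48 * sin w * w - 120 * (1 - cos w).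
  by field; rewrite gt_eqF.
have [[c1 c2] s1] := (cos_le1 w, cos_geN1 w, sin_geN1 w).
have w2 : 0 <= w ^+ 2 by exact: sqr_ge0.
have h1 : 0 <= (1 - cos w) * w ^+ 2 by rewrite mulr_ge0// subr_ge0.
have h2 : 0 <= (sin w + 1) * w by apply: mulr_ge0; [rewrite -lerBlDr sub0r|exact: ltW].
move: (cos w) (sin w) c1 c2 s1 h1 h2 => c s c1 c2 s1 h1 h2; lra.
Qed.

(** The numerator is 12 times [w ^ 2 - 4 * w - 20], whose larger root is below 7; from 8 on it is at
    least 144. *)
Lemma weight_transform_ge0 (w : R) : 8 <= w -> 0 <= weight_transform w.
Proof.
move=> w8; apply: le_trans (weight_transform_ge _); last by lra.
by rewrite divr_ge0 ?exprn_ge0//; [nra|lra].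
Qed.

Lemma weight_transform_gt0 (v : R) : 0 < v ->
  exists2 c, 0 < c & forall w, 8 <= w -> w <= v -> c <= weight_transform w.
Proof.
move=> v0; have v6 : 0 < v ^+ 6 by rewrite exprn_gt0.
(* On this range the numerator is at least 1 and [w ^ 6 <= v ^ 6]. *)
exists (v ^+ 6)^-1 => [|w w8 wv]; first by rewrite invr_gt0.
apply: le_trans (weight_transform_ge _); last by lra.
rewrite -[leLHS]mul1r; apply: ler_pM => //.
- by rewrite invr_ge0 ltW.
- nra.
- rewrite lef_pV2 ?posrE ?exprn_gt0//; last by lra.
  by rewrite lerXn2r// nnegrE; lra.
Qed.

End weight.

(** * Fubini's theorem with a bounded kernel *)

Section Fubini.
Context {R : realType} {d1 d2 : measure_display}.
Context {T1 : measurableType d1} {T2 : measurableType d2}.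
Variables (m1 : {sigma_finite_measure set T1 -> \bar R}).
Variables (m2 : {sigma_finite_measure set T2 -> \bar R}).

Lemma finsupp_tensor (f : T1 -> R) (g : T2 -> R) :
  finsupp m1 f -> finsupp m2 g -> finsupp (m1 \x m2)%E (fun z => f z.1 * g z.2).
Proof.
move=> [mf [M [A [mA fA fM f0]]]] [mg [N [B [mB fB gN g0]]]]; split.
  by apply: measurable_funM; apply: measurableT_comp.
exists (M * N), (A `*` B); split => [| |z|z].
- exact: measurableX.
- by rewrite [ltLHS]product_measure1E// lte_mul_pinfty// ge0_fin_numE.
- by rewrite normrM ler_pM.
- by move=> /not_andP[/f0 ->|/g0 ->]; rewrite ?mul0r ?mulr0.
Qed.

Lemma Rintegral_prod1 (F : T1 * T2 -> R) : finsupp (m1 \x m2)%E F ->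
  (forall x, finsupp m2 (fun y => F (x, y))) ->
  measurable_fun setT (fun x => \int[m2]_y F (x, y)) /\
  \int[m1]_x \int[m2]_y F (x, y) = \int[(m1 \x m2)%E]_z F z.
Proof.
move=> hF hx.
have E x : ((\int[m2]_y F (x, y))%:E = fubini_F m2 (EFin \o F) x)%E.
  rewrite /Rintegral fineK//; apply: integrable_fin_num => //.
  exact: finsupp_integrable (hx x).
split; last first.
  rewrite /Rintegral -integral12_prod_meas1; last exact: finsupp_integrable.
  by congr fine; apply: eq_integral => x _; rewrite -E.
apply/measurable_EFinP; rewrite (_ : _ \o _ = fubini_F m2 (EFin \o F)).
  by apply: (measurable_fubini_F (m1 := m1)); exact: finsupp_integrable.
by apply/funext => x; rewrite /= E.
Qed.

Lemma Rintegral_prod2 (F : T1 * T2 -> R) : finsupp (m1 \x m2)%E F ->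
  (forall y, finsupp m1 (fun x => F (x, y))) ->
  \int[m2]_y \int[m1]_x F (x, y) = \int[(m1 \x m2)%E]_z F z.
Proof.
move=> hF hy; rewrite /Rintegral -integral21_prod_meas1; last exact: finsupp_integrable.
congr fine; apply: eq_integral => y _.
rewrite fineK//; apply: integrable_fin_num => //.
exact: finsupp_integrable (hy y).
Qed.

Section bounded_kernel.
Variables (W : T1 -> R) (f : T2 -> R) (k : T1 * T2 -> R).
Hypotheses (hW : finsupp m1 W) (hf : finsupp m2 f).
Hypotheses (mk : measurable_fun setT k) (k1 : forall z, `|k z| <= 1).

Let hF : finsupp (m1 \x m2)%E (fun z => W z.1 * f z.2 * k z).
Proof. by apply: finsuppM; [exact: finsupp_tensor|by []|exists 1]. Qed.

Let mk1 x : measurable_fun setT (fun y => k (x, y)).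
Proof. exact: measurableT_comp. Qed.

Let mk2 y : measurable_fun setT (fun x => k (x, y)).
Proof. exact: measurableT_comp. Qed.

Let hx x : finsupp m2 (fun y => f y * k (x, y)).
Proof. by apply: finsuppM => //; exists 1. Qed.

Let hy y : finsupp m1 (fun x => W x * k (x, y)).
Proof. by apply: finsuppM => //; exists 1. Qed.

Let hFx x : finsupp m2 (fun y => W x * f y * k (x, y)).
Proof.
rewrite (_ : (fun _ => _) = (fun y => W x * (f y * k (x, y)))).
  exact: finsuppZ.
by apply/funext => y; rewrite mulrA.
Qed.

Let hFy y : finsupp m1 (fun x => W x * f y * k (x, y)).
Proof.
rewrite (_ : (fun _ => _) = (fun x => f y * (W x * k (x, y)))).
  exact: finsuppZ.
by apply/funext => x; rewrite mulrA (mulrC (f y)).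
Qed.

(** With cosine and sine kernels, this makes the transforms of [f], cut off to a bounded range of
    [delta], measurable and bounded. *)
Lemma finsupp_Rintegral_kernel :
  finsupp m1 (fun x => W x * \int[m2]_y (f y * k (x, y))).
Proof.
have E x : W x * \int[m2]_y (f y * k (x, y)) =
    \int[m2]_y (W x * f y * k (x, y)).
  by rewrite -finsupp_RintegralZ//; apply: eq_Rintegral => y _; rewrite mulrA.
split.
  under eq_fun do rewrite E; exact: (Rintegral_prod1 hF hFx).1.
have [mW [M [A [mA fA WM W0]]]] := hW.
exists (M * \int[m2]_y `|f y|), A; split => // x; last first.
  by move=> /W0 ->; rewrite mul0r.
rewrite normrM ler_pM//.
apply: le_trans (le_normr_Rintegral _ _) _ => //; first exact: finsupp_integrable.
apply: le_Rintegral => //.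
- by apply: integrable_norm; exact: finsupp_integrable.
- by apply: integrable_norm; exact: finsupp_integrable.
- by move=> y _; rewrite normrM ler_piMr.
Qed.

Lemma Rintegral_kernel_Fubini :
  \int[m1]_x (W x * \int[m2]_y (f y * k (x, y))) =
  \int[m2]_y (f y * \int[m1]_x (W x * k (x, y))).
Proof.
transitivity (\int[(m1 \x m2)%E]_z (W z.1 * f z.2 * k z)).
  rewrite -(Rintegral_prod1 hF hFx).2; apply: eq_Rintegral => x _.
  by rewrite -finsupp_RintegralZ//; apply: eq_Rintegral => y _; rewrite mulrA.
rewrite -(Rintegral_prod2 hF hFy); apply: eq_Rintegral => y _.
rewrite -finsupp_RintegralZ//; apply: eq_Rintegral => x _.
by rewrite mulrA (mulrC (f y)).
Qed.

End bounded_kernel.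
End Fubini.

(** * The averaged lower bound by duality *)

Section lower.
Context {R : realType}.
Notation mu := (@lebesgue_measure R).
Variable f : R -> R.
Hypotheses (hf : finsupp mu f) (f0 : forall x, 0 <= f x).

Let u : R -> R := \1_`[0, 1].

Let hu : finsupp mu u /\ \int[mu]_d u d = 1.
Proof. by have [h ->] := @finsupp_itv R 0 1 ler01; rewrite subr0. Qed.

(** For [f] the chord profile and [t = 2 * pi * rho], this is the squared modulus of the transform
    of the dilate by [d]. The cutoff to [0, 1] is built in so that integrals run over the whole
    line. *)
Definition weighted_power (t d : R) : R :=
  \1_`[0, 1] d * (d ^+ 4 *
    (cos_transform f (t * d) ^+ 2 + sin_transform f (t * d) ^+ 2)).

Let measurable_phase (A B : R) :
  measurable_fun setT (fun z : R * R => z.1 * (A + B * z.2)).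
Proof.
apply: measurable_funM => //; apply: measurable_funD => //.
exact: measurable_funM.
Qed.

Let mcos (A B : R) : measurable_fun setT (fun z : R * R => cos (z.1 * (A + B * z.2))).
Proof.
apply: measurableT_comp; last exact: measurable_phase.
by apply: continuous_measurable_fun; exact: continuous_cos.
Qed.

Let msin (A B : R) : measurable_fun setT (fun z : R * R => sin (z.1 * (A + B * z.2))).
Proof.
apply: measurableT_comp; last exact: measurable_phase.
by apply: continuous_measurable_fun; exact: continuous_sin.
Qed.

Lemma finsupp_weighted_power t : finsupp mu (weighted_power t).
Proof.
have hX : finsupp mu (fun d => u d * cos_transform f (t * d)).
  have := finsupp_Rintegral_kernel hu.1 hf (mcos 0 t) (fun z => normr_cos_le1 _).
  congr (finsupp _ _); apply/funext => d; congr (_ * _).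
  by apply: eq_Rintegral => x _ /=; rewrite add0r mulrA (mulrC d).
have hY : finsupp mu (fun d => u d * sin_transform f (t * d)).
  have := finsupp_Rintegral_kernel hu.1 hf (msin 0 t) (fun z => normr_sin_le1 _).
  congr (finsupp _ _); apply/funext => d; congr (_ * _).
  by apply: eq_Rintegral => x _ /=; rewrite add0r mulrA (mulrC d).
have sq (g : R -> R) : finsupp mu g -> finsupp mu (fun d => g d * g d).
  move=> hg; apply: finsuppM => //; first by case: hg.
  by case: hg => _ [M [B [_ _ gM _]]]; exists M.
have := finsuppD (sq _ hX) (sq _ hY).
have m4 : measurable_fun setT (fun d : R => u d * d ^+ 4).
  by apply: measurable_funM; [case: hu => -[]|exact: measurable_funX].
move=> /finsuppM/(_ m4); have b4 : exists K, forall d, `|u d * d ^+ 4| <= K.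
  exists 1 => d; rewrite /u indicE; case: (boolP (_ \in _)); last first.
    by rewrite mul0r normr0.
  rewrite inE /= in_itv /= => /andP[d0 d1]; rewrite mul1r normrX exprn_ile1//.
  by rewrite ger0_norm.
move=> /(_ b4); congr (finsupp _ _); apply/funext => d.
rewrite /weighted_power /u indicE; by case: (_ \in _) => /=; ring.
Qed.

Variables (A B a b c v x1 x2 : R).
Hypotheses (supp : forall x, ~ (a < x < b) -> f x = 0).
Hypotheses (phase_ge : forall x, a < x < b -> 8 <= A + B * x).
Hypotheses (ax1 : a < x1) (x12 : x1 <= x2) (x2b : x2 < b) (v0 : 0 <= v).
Hypotheses (fv : forall x, x1 <= x -> x <= x2 -> v <= f x).
Hypotheses (c0 : 0 <= c)
  (fc : forall x, x1 <= x -> x <= x2 -> c <= weight_transform (A + B * x)).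

(* [G >= 2 * m * h - m ^ 2] for every [G >= h ^ 2]: this replaces the
   Cauchy-Schwarz inequality in the duality argument. *)
Lemma weighted_power_ge :
  (v * (x2 - x1) * c) ^+ 2 <= \int[mu]_d weighted_power B d.
Proof.
have [m mE] : exists m, m = v * (x2 - x1) * c by exists (v * (x2 - x1) * c).
rewrite -mE.
have [W WE] : exists W, W = fun d => u d * weight d by eexists.
have hW : finsupp mu W.
  (* [weight] is unbounded on the line; using [u * u = u] it is cut off once more, to become a
     bounded factor. *)
  rewrite WE (_ : (fun d => _) = (fun d => u d * (u d * weight d))); last first.
    apply/funext => d; rewrite mulrA; congr (_ * _).
    by rewrite /u indicE; case: (_ \in _); rewrite ?mul1r ?mul0r.
  apply: finsuppM => //; first by case: hu.
    apply: measurable_funM; first by case: hu => -[].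
    apply: measurable_funN; apply: measurable_funM; apply: measurable_funX => //.
    by apply: measurable_funB.
  exists 1 => d; rewrite /u indicE; case: (boolP (_ \in _)); last first.
    by rewrite mul0r normr0.
  rewrite inE /= in_itv /= => /andP[d0 d1]; rewrite mul1r normrN normrM !normrX.
  by rewrite mulr_ile1 ?exprn_ge0 ?exprn_ile1 ?normr_ge0// ger0_norm//; lra.
have [w w_def] : exists w, w = fun d => \int[mu]_x (f x * cos (d * (A + B * x))).
  by eexists.
have hWw : finsupp mu (fun d => W d * w d).
  rewrite w_def.
  exact: (finsupp_Rintegral_kernel hW hf (mcos A B) (fun z => normr_cos_le1 _)).
have hcos d : finsupp mu (fun x => f x * cos (B * d * x)).
  apply: finsuppM => //; first exact: measurable_cosM.
  by exists 1 => x; exact: normr_cos_le1.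
have hsin d : finsupp mu (fun x => f x * sin (B * d * x)).
  apply: finsuppM => //; first exact: measurable_sinM.
  by exists 1 => x; exact: normr_sin_le1.
have wE d : w d = cos (d * A) * cos_transform f (B * d) -
                  sin (d * A) * sin_transform f (B * d).
  rewrite w_def -!finsupp_RintegralZ// -finsupp_RintegralB; [|exact: finsuppZ..].
  apply: eq_Rintegral => x _.
  rewrite (_ : d * (A + B * x) = d * A + B * d * x); last by ring.
  by rewrite cosD; ring.
(* [w d] is one coordinate of the vector of the two transforms rotated by the angle [d * A], so its
   square is at most the squared length. This is where [A] becomes free. *)
have w2 d : w d ^+ 2 <= cos_transform f (B * d) ^+ 2 + sin_transform f (B * d) ^+ 2.
  rewrite wE; have := cos2Dsin2 (d * A).
  move: (cos _) (sin _) (cos_transform _ _) (sin_transform _ _) => p q X Y pq.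
  have -> : X ^+ 2 + Y ^+ 2 = (p * X - q * Y) ^+ 2 + (q * X + p * Y) ^+ 2.
    by rewrite -[X ^+ 2]mul1r -[Y ^+ 2]mul1r -pq; ring.
  by rewrite lerDl sqr_ge0.
have pointwise d : 2 * m * (W d * w d) - m ^+ 2 * u d <= weighted_power B d.
  rewrite WE /weighted_power -/u {1 2 3}/u indicE.
  case: (boolP (_ \in _)); last by rewrite !mul0r !mulr0 subr0.
  rewrite inE /= in_itv /= => /andP[d0 d1]; rewrite !mul1r mulr1.
  apply: (@le_trans _ _ (weight d ^+ 2 * w d ^+ 2)).
    have := sqr_ge0 (weight d * w d - m); rewrite sqrrB exprMn.
    move: (weight d) (w d) => p q H.
    rewrite -subr_ge0; apply: le_trans H _; rewrite le_eqVlt; apply/orP; left.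
    by apply/eqP; ring.
  (* The square of [weight] is [d ^ 4 * (1 - d) ^ 6], at most [d ^ 4] on [0, 1]: this is the purpose
     of its factor [d ^ 2]. *)
  apply: ler_pM; rewrite ?sqr_ge0// /weight sqrrN exprMn -!exprM.
  rewrite ler_piMr ?exprn_ge0// exprn_ile1//; lra.
have Ww : \int[mu]_d (W d * w d) =
    \int[mu]_x (f x * \int[mu]_d (W d * cos (d * (A + B * x)))).
  rewrite w_def.
  exact: (Rintegral_kernel_Fubini hW hf (mcos A B) (fun z => normr_cos_le1 _)).
have WK x : a < x < b ->
    \int[mu]_d (W d * cos (d * (A + B * x))) = weight_transform (A + B * x).
  move=> /phase_ge ph; rewrite -Rintegral_weight_cos; last first.
    by rewrite gt_eqF// (lt_le_trans _ ph).
  rewrite [RHS]Rintegral_mkcond; apply: eq_Rintegral => d _.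
  rewrite patchE WE /u indicE; case: (_ \in _); rewrite ?mul0r// mul1r.
  by rewrite (mulrC d).
have hfK : finsupp mu (fun x => f x * \int[mu]_d (W d * cos (d * (A + B * x)))).
  have mk : measurable_fun setT (fun z : R * R => cos (z.2 * (A + B * z.1))).
    exact: (measurableT_comp (mcos A B) (@measurable_swap _ _ R R)).
  exact: (finsupp_Rintegral_kernel hf hW mk (fun z => normr_cos_le1 _)).
have hind := @finsupp_itv R x1 x2 x12.
have Ww_ge : m <= \int[mu]_d (W d * w d).
  (* After Fubini the integrand is nonnegative everywhere and at least [v * c] on the window
     [[x1, x2]]. *)
  rewrite Ww; have -> : m = \int[mu]_x (v * c * \1_`[x1, x2] x).
    by rewrite finsupp_RintegralZ ?hind.2 ?mE; [ring|exact: hind.1].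
  apply: finsupp_le_Rintegral => //; first by apply: finsuppZ; exact: hind.1.
  move=> x; have [xab|/negP xab] := boolP (a < x < b); last first.
    rewrite supp// mul0r indicE memNset ?mulr0//=.
    rewrite in_itv/= => /andP[xx1 xx2]; apply: xab.
    by rewrite (lt_le_trans ax1 xx1) (le_lt_trans xx2 x2b).
  rewrite WK//; rewrite indicE; case: (boolP (_ \in _)); last first.
    by rewrite mulr0 mulr_ge0// weight_transform_ge0// phase_ge.
  rewrite inE/= in_itv/= => /andP[xx1 xx2]; rewrite mulr1.
  by rewrite ler_pM// ?fv// fc.
have : \int[mu]_d (2 * m * (W d * w d) - m ^+ 2 * u d) <= \int[mu]_d weighted_power B d.
  apply: finsupp_le_Rintegral => //; last exact: finsupp_weighted_power.
  by apply: finsuppB; apply: finsuppZ => //; exact: hu.1.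
apply: le_trans; rewrite finsupp_RintegralB; [|exact: finsuppZ|apply: finsuppZ; exact: hu.1].
rewrite finsupp_RintegralZ// finsupp_RintegralZ; last exact: hu.1.
rewrite hu.2 mulr1 -mulrA; have m0 : 0 <= m.
  by rewrite mE !mulr_ge0// subr_ge0.
(* The pairing being at least [m], twice [m] times it minus [m ^ 2] is at least [m ^ 2]. *)
have : m * m <= m * \int[mu]_d (W d * w d) by rewrite ler_wpM2l.
by rewrite expr2; move: (m * _) (m * _) => p q; lra.
Qed.

End lower.

(** * Both bounds in terms of the two end chords *)

Section weighted_power_bounds.
Context {R : realType}.
Notation mu := (@lebesgue_measure R).

(** Reflection lets the estimates proved next to [a] serve next to [b]. *)
Lemma concave_itvN (f : R -> R) (a b : R) :
  concave_itv f a b -> concave_itv (fun x => f (- x)) (- b) (- a).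
Proof.
move=> cf x z y bx xz zy ya.
have H : (- x - - z) * f (- y) + (- z - - y) * f (- x) <= (- x - - y) * f (- z).
  by apply: cf; rewrite ?ltrN2//; [rewrite ltrNr|rewrite ltrNl].
move: H; move: (f (- x)) (f (- y)) (f (- z)) => p q r H.
have : (y - z) * p + (z - x) * q <= (y - x) * r by lra.
by [].
Qed.

Lemma sin_transformN (f : R -> R) (t : R) : finsupp mu f ->
  sin_transform f (- t) = - sin_transform f t.
Proof.
move=> hf; have h : finsupp mu (fun x => f x * sin (t * x)).
  apply: finsuppM => //; first exact: measurable_sinM.
  by exists 1 => x; exact: normr_sin_le1.
have := finsupp_RintegralZ (-1) h; rewrite mulN1r => <-.
by apply: eq_Rintegral => x _; rewrite mulNr sinN; ring.
Qed.

(** A reversed frequency makes the phase grow towards the left, so that the right end can be the one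
    put at phase 8. *)
Lemma weighted_powerN (f : R -> R) (t : R) : finsupp mu f ->
  weighted_power f (- t) = weighted_power f t.
Proof.
move=> hf; apply/funext => d; rewrite /weighted_power; congr (_ * (_ * (_ + _))).
  congr (_ ^+ 2); apply: eq_Rintegral => x _.
  by rewrite !mulNr cosN.
by rewrite mulNr sin_transformN// sqrrN.
Qed.

Lemma pi_lt4 : (pi : R) < 4.
Proof. by have := pihalf_lt2 R; rewrite ltr_pdivrMr// -natrM. Qed.

Variables (f : R -> R) (a b s : R).
Hypotheses (hf : finsupp mu f) (f0 : forall x, 0 <= f x).
Hypotheses (cf : concave_itv f a b) (supp : forall x, ~ (a < x < b) -> f x = 0).
Hypotheses (s0 : 0 < s) (sab : 11 * s <= b - a).

Let g := Num.max (f (a + s)) (f (b - s)).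

Let cf' : concave_itv (fun x => f (- x)) (- b) (- a).
Proof. exact: concave_itvN. Qed.

Lemma weighted_power_le d :
  weighted_power f (2 * pi / s) d <= 2 * s ^+ 2 * g ^+ 2 * \1_`[0, 1] d.
Proof.
have [s0' sab'] := (s0, sab).
have g0 : 0 <= g by rewrite le_max f0.
rewrite /weighted_power indicE; case: (boolP (_ \in _)); last first.
  by rewrite mul0r mulr0.
rewrite inE /= in_itv /= mul1r mulr1 => /andP[]; rewrite le_eqVlt.
(* At [d = 0] there is no half-period, but the left side vanishes with [d ^ 4]. *)
move=> /predU1P[<- _|d0 d1].
  by rewrite expr0n /= mul0r -mulrA mulr_ge0// mulr_ge0 ?sqr_ge0.
(* [h] is the half-period at frequency [2 * pi * d / s], and [K] is the bound of [concave_le] up to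
   distance [2 * h = s / d] from either end. *)
set K := 10 / 9 * g / d; set h := s / (2 * d).
have h0 : 0 < h by rewrite divr_gt0// mulr_gt0.
have K0 : 0 <= K by rewrite !mulr_ge0// invr_ge0 ltW.
have hE : 2 * h = s / d by rewrite /h; field; rewrite gt_eqF.
have Kle v : v <= g -> 10 / 9 * v / d <= K.
  by move=> vg; rewrite ler_wpM2r ?invr_ge0 ?(ltW d0)// ler_wpM2l//; lra.
have fa x : a < x -> x < b -> x <= a + 2 * h -> f x <= K.
  rewrite hE => ax xb xh; apply: le_trans (Kle (f (a + s)) _).
    by apply: (concave_le cf) => //; lra.
  by rewrite le_max lexx.
have fb x : a < x -> x < b -> b - 2 * h <= x -> f x <= K.
  rewrite hE => ax xb xh; apply: le_trans (Kle (f (b - s)) _); last first.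
    by rewrite le_max lexx orbT.
  have := @concave_le _ _ (- b) (- a) s cf' (fun _ => f0 _) s0 ltac:(lra) d (- x) d0 d1.
  by rewrite opprK opprD opprK; apply; lra.
have := transform_sqr_le hf cf f0 supp h0 K0 fa fb.
have -> : pi / h = 2 * pi / s * d.
  by rewrite /h; field; rewrite !gt_eqF.
move=> H; have d4 : 0 <= d ^+ 4 by rewrite exprn_ge0// ltW.
apply: (le_trans (ler_wpM2l d4 H)).
(* The constant that remains is [(10 / 9) ^ 2], below 2. *)
rewrite hE /K; have -> : d ^+ 4 * (s / d * (10 / 9 * g / d)) ^+ 2 =
    100 / 81 * (s ^+ 2 * g ^+ 2) by field; rewrite gt_eqF.
rewrite -[leRHS]mulrA ler_wpM2r ?mulr_ge0 ?sqr_ge0//; lra.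
Qed.

Lemma Rintegral_weighted_power_le :
  \int[mu]_d weighted_power f (2 * pi / s) d <= 2 * s ^+ 2 * g ^+ 2.
Proof.
have [h i1] := @finsupp_itv R 0 1 ler01.
have := finsupp_le_Rintegral (finsupp_weighted_power hf (2 * pi / s))
  (finsuppZ (2 * s ^+ 2 * g ^+ 2) h) weighted_power_le.
by rewrite finsupp_RintegralZ// i1 subr0 mulr1.
Qed.

Lemma Rintegral_weighted_power_ge c : 0 <= c ->
  (forall w, 8 <= w -> w <= 24 -> c <= weight_transform w) ->
  (8 / 9 * c) ^+ 2 * s ^+ 2 * g ^+ 2 <= \int[mu]_d weighted_power f (2 * pi / s) d.
Proof.
move=> c0 wc; have [s0' sab'] := (s0, sab).
(* Since [pi <= 4], the phase [8 + 2 * pi * r] with [1 <= r <= 2] stays in [8, 24], where [c] is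
   available. *)
have [p2 p4] := (pi_ge2 R, ltW pi_lt4).
set P : R := pi in p2 p4 *.
have Ps x : 2 * P / s * x = 2 * P * (x / s) by ring.
have ss x : x * s / s = x by rewrite mulfK// gt_eqF.
have [fba|fab] := leP (f (b - s)) (f (a + s)).
  have gE : g = f (a + s) by apply/max_idPl.
  (* The constant term puts the phase 8 at [a]; on the window from [a + s] to [a + 2 * s],
     [concave_ge] keeps 8/9 of the end chord. *)
  have := @weighted_power_ge R f hf f0 (8 - 2 * P / s * a) (2 * P / s) a b c
    (8 / 9 * f (a + s)) (a + s) (a + 2 * s) supp.
  have E x : 8 - 2 * P / s * a + 2 * P / s * x = 8 + 2 * P * ((x - a) / s) by ring.
  have -> : 8 / 9 * f (a + s) * (a + 2 * s - (a + s)) * c =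
    8 / 9 * c * (s * g) by rewrite gE; ring.
  rewrite exprMn [(s * g) ^+ 2]exprMn mulrA; apply; rewrite ?mulr_ge0//.
  - move=> x /andP[ax _]; rewrite E lerDl mulr_ge0//; first lra.
    by rewrite divr_ge0 ?subr_ge0// ltW.
  - lra.
  - lra.
  - lra.
  - by move=> x x1 x2; apply: (@concave_ge _ _ a b s) => //; lra.
  - move=> x x1 x2; rewrite E.
    have : 1 <= (x - a) / s by rewrite ler_pdivlMr//; lra.
    have : (x - a) / s <= 2 by rewrite ler_pdivrMr//; lra.
    move: ((x - a) / s) => r r2 r1; by apply: wc; nra.
have gE : g = f (b - s) by apply/max_idPr/ltW.
rewrite -weighted_powerN//.
have := @weighted_power_ge R f hf f0 (8 + 2 * P / s * b) (- (2 * P / s)) a b c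
    (8 / 9 * f (b - s)) (b - 2 * s) (b - s) supp.
have E x : 8 + 2 * P / s * b + - (2 * P / s) * x = 8 + 2 * P * ((b - x) / s) by ring.
have -> : 8 / 9 * f (b - s) * (b - s - (b - 2 * s)) * c =
    8 / 9 * c * (s * g) by rewrite gE; ring.
rewrite exprMn [(s * g) ^+ 2]exprMn mulrA; apply; rewrite ?mulr_ge0//.
- move=> x /andP[_ xb]; rewrite E lerDl mulr_ge0//; first lra.
  by rewrite divr_ge0 ?subr_ge0// ltW.
- lra.
- lra.
- lra.
- move=> x x1 x2.
  have := @concave_ge _ _ (- b) (- a) s cf' (fun _ => f0 _) s0 ltac:(lra) (- x).
  by rewrite opprK opprD opprK; apply; lra.
- move=> x x1 x2; rewrite E.
  have : 1 <= (b - x) / s by rewrite ler_pdivlMr//; lra.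
  have : (b - x) / s <= 2 by rewrite ler_pdivrMr//; lra.
  move: ((b - x) / s) => r r2 r1; by apply: wc; nra.
Qed.

End weighted_power_bounds.

(** * Integration in the plane *)

Section lower_integral.
Context d (T : measurableType d) (R : realType).
Variable mu : {measure set T -> \bar R}.

(** The integral is a supremum over the simple functions below the restricted integrand, and
    enlarging the domain only admits more of them; measurability does not enter. *)
Lemma ge0_subset_integral_nonmeasurable (A B : set T) (g : T -> \bar R) :
  A `<=` B -> (forall x, 0 <= g x)%E ->
  (\int[mu]_(x in A) g x <= \int[mu]_(x in B) g x)%E.
Proof.
move=> AB g0; rewrite !ge0_integralE//; apply: le_ereal_sup => _ [h /= hg <-].
exists h => // x; apply: le_trans (hg x) _.
rewrite !patchE; case: ifPn => [/set_mem/AB/mem_set ->//|_].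
by case: ifPn.
Qed.

Lemma ge0_integral_mod_null (U C Z : set T) (g : T -> \bar R) :
  measurable U -> measurable Z -> mu Z = 0%E -> U `<=` C -> C `<=` U `|` Z ->
  measurable_fun setT g -> (forall x, 0 <= g x)%E ->
  (\int[mu]_(x in C) g x = \int[mu]_(x in U) g x)%E.
Proof.
move=> mU mZ Z0 UC CUZ mg g0; apply/eqP; rewrite eq_le; apply/andP; split.
  apply: le_trans (ge0_subset_integral_nonmeasurable CUZ g0) _.
  have mUZ : measurable (U `|` Z) by exact: measurableU.
  rewrite (ge0_negligible_integral mZ mUZ) => //; last exact: measurable_funTS.
  apply: ge0_subset_integral_nonmeasurable => // x [] [//|Zx nZ].
  by have := nZ Zx.
exact: ge0_subset_integral_nonmeasurable.
Qed.

Lemma Rintegral_mod_null (U C Z : set T) (g : T -> R) :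
  measurable U -> measurable Z -> mu Z = 0%E -> U `<=` C -> C `<=` U `|` Z ->
  measurable_fun setT g -> \int[mu]_(x in C) g x = \int[mu]_(x in U) g x.
Proof.
move=> mU mZ Z0 UC CUZ /measurable_EFinP mg.
rewrite /Rintegral; congr fine; rewrite integralE [RHS]integralE.
congr (_ - _)%E; apply: ge0_integral_mod_null mZ Z0 UC CUZ _ _ => //.
- exact: measurable_funepos.
- exact: measurable_funeneg.
Qed.

End lower_integral.

(** * Linear changes of variable in the plane *)

Section plane_measure.
Context {R : realType}.
Notation mu := (@lebesgue_measure R).
Notation mu2 := (mu \x mu)%E.

(** For an invertible linear [N], the factor [c] is the inverse of the absolute value of its
    determinant. *)
Definition scales (c : R) (N : R * R -> R * R) :=
  measurable_fun setT N /\
  forall A, measurable A -> mu2 (N @^-1` A) = (c%:E * mu2 A)%E.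

Lemma measurable_preimage (N : R * R -> R * R) (A : set (R * R)) :
  measurable_fun setT N -> measurable A -> measurable (N @^-1` A).
Proof. by move=> mN mA; rewrite -[X in measurable X]setTI; exact: mN. Qed.

Lemma scales_comp c c' (N N' : R * R -> R * R) :
  scales c N -> scales c' N' -> scales (c * c') (N' \o N).
Proof.
move=> [mN sN] [mN' sN']; split; first exact: measurableT_comp.
move=> A mA; rewrite comp_preimage sN ?sN'//; last exact: measurable_preimage.
by rewrite muleA EFinM.
Qed.

Lemma scales_swap : scales 1 (fun z => (z.2, z.1)).
Proof.
split; first exact: measurable_swap.
move=> A mA; rewrite mul1e.
rewrite [RHS](@product_measure_unique _ _ _ _ _ mu mu (mu \x^ mu)%E)//.
by move=> B D mB mD; rewrite [LHS]product_measure2E.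
Qed.

(** Each vertical section is an affine preimage, so the one-dimensional scaling integrates to the
    plane. *)
Lemma scales_shear (a t : R) : a != 0 ->
  scales `|a|^-1 (fun z => (z.1, a * z.2 + t * z.1)).
Proof.
move=> a0; split.
  apply: measurable_fun_pair => //; apply: measurable_funD.
    by apply: measurable_funM.
  by apply: measurable_funM.
move=> A mA; rewrite /product_measure1.
have mphi : measurable_fun [set: measurableTypeR R] (mu \o xsection A) by exact: measurable_fun_xsection.
have ka : (0 <= (`|a|^-1)%:E :> \bar R)%E by rewrite lee_fin invr_ge0.
rewrite -(ge0_integralZl _ measurableT mphi _ ka)//.
apply: eq_integral => x _ /=.
by rewrite -(lebesgue_measure_affine (t * x))//; exact: measurable_xsection.
Qed.

(** Gaussian elimination: the similarity is a product of swaps and shears. When [al = 0] there is no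
    pivot and a separate product is used. *)
Lemma scales_similarity (al be : R) : al ^+ 2 + be ^+ 2 != 0 ->
  scales (al ^+ 2 + be ^+ 2)^-1
    (fun z => (al * z.1 + be * z.2, - be * z.1 + al * z.2)).
Proof.
have [-> be0|al0 d0] := eqVneq al 0.
  have {}be0 : be != 0 by move: be0; rewrite expr0n add0r sqrf_eq0.
  have := scales_comp (scales_comp (scales_comp (scales_comp scales_swap
    (@scales_shear (- be) 0 _)) scales_swap) (@scales_shear be 0 be0)) scales_swap.
  rewrite oppr_eq0 => /(_ be0).
  congr (scales _ _); last first.
    by apply/funext => z /=; rewrite !mul0r !addr0 add0r.
  rewrite normrN !mul1r !mulr1 expr0n add0r -invfM -normrM -expr2 ger0_norm//.
  exact: sqr_ge0.
have da0 : (al ^+ 2 + be ^+ 2) / al != 0 by rewrite mulf_neq0// invr_neq0.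
have := scales_comp (scales_comp (scales_comp scales_swap
    (@scales_shear al be al0)) scales_swap) (@scales_shear _ (- be / al) da0).
congr (scales _ _); last first.
  by apply/funext => z /=; congr pair; field.
rewrite mul1r mulr1 -invfM -normrM mulrCA divff// mulr1 ger0_norm//.
by rewrite addr_ge0 ?sqr_ge0.
Qed.

Lemma Rintegral_scales (c : R) (N : R * R -> R * R) (k : R * R -> R) :
  0 <= c -> scales c N -> finsupp mu2 k ->
  \int[mu2]_z k (N z) = c * \int[mu2]_z k z.
Proof.
move=> c0 [mN sN] hk; have ik := finsupp_integrable hk.
pose T2 := (measurableTypeR R * measurableTypeR R)%type.
have key (g : T2 -> \bar R) : measurable_fun setT g -> (forall z, 0 <= g z)%E ->
    (\int[mu2]_z g (N z) = c%:E * \int[mu2]_z g z)%E.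
  move=> mg g0; pose N' : T2 -> T2 := N.
  have mN' : measurable_fun setT N' by exact: mN.
  rewrite -(@ge0_integral_mscale _ _ _ mu2 setT measurableT (NngNum c0) g)//.
  transitivity (\int[pushforward mu2 N']_z g z)%E.
    by rewrite ge0_integral_pushforward// preimage_setT.
  by apply: eq_measure_integral => A mA _; rewrite [LHS]sN.
pose kE : T2 -> \bar R := EFin \o k.
have mk : measurable_fun setT kE by apply/measurable_EFinP; case: hk.
rewrite /Rintegral -[c]/(fine c%:E) -fineM//; last exact: integrable_fin_num.
congr fine; rewrite integralE.
transitivity (\int[mu2]_z (kE^\+ (N z)) - \int[mu2]_z (kE^\- (N z)))%E.
  by congr (_ - _)%E; apply: eq_integral => z _; rewrite ?funeposE ?funenegE.
rewrite (key kE^\+%E (measurable_funepos mk) (funepos_ge0 _)).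
rewrite (key kE^\-%E (measurable_funeneg mk) (funeneg_ge0 _)).
rewrite [X in _ = (_ * X)%E]integralE [RHS]muleBr//.
by apply: fin_num_adde_defr; exact: integrable_pos_fin_num.
Qed.

End plane_measure.

(** * Slices of a convex set *)

Section interval_length.
Context {R : realType}.
Notation mu := (@lebesgue_measure R).

Lemma lebesgue_measure_interval (E : set R) : is_interval E -> E !=set0 ->
  has_lbound E -> has_ubound E -> mu E = (sup E - inf E)%:E.
Proof.
move=> iE [x Ex] lE uE.
have xs : x <= sup E by exact: ub_le_sup.
have ix : inf E <= x by exact: ge_inf.
have Eoo : `]inf E, sup E[ `<=` E.
  move=> y /=; rewrite in_itv /= => /andP[y1 y2].
  have [z Ez zy] := inf_lt (ex_intro _ x Ex : E !=set0) y1.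
  have [w Ew yw] := sup_gt (ex_intro _ x Ex : E !=set0) y2.
  by apply: (iE z w) => //; rewrite (ltW zy) (ltW yw).
have Ecc : E `<=` `[inf E, sup E].
  move=> y Ey /=; rewrite in_itv /=; apply/andP; split; [exact: ge_inf|exact: ub_le_sup].
have mE : measurable E by exact: is_interval_measurable.
apply/eqP; rewrite eq_le; apply/andP; split.
  apply: (le_trans (le_measure mu _ _ Ecc)); rewrite ?inE//.
  rewrite [leLHS]lebesgue_measure_itv /= lte_fin; case: ltP => // _.
  by rewrite lee_fin subr_ge0 (le_trans ix xs).
apply: le_trans (le_measure mu _ _ Eoo); rewrite ?inE//.
rewrite [leRHS]lebesgue_measure_itv /= lte_fin; case: ltP => //.
by rewrite lee_fin subr_le0.
Qed.

(** Meant for concave functions, whose superlevel sets are intervals; no continuity is required. *)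
Lemma measurable_fun_superlevel_interval (I : set R) (g : R -> R) :
  measurable I -> (forall y, is_interval (I `&` [set x | y < g x])) ->
  measurable_fun I g.
Proof.
move=> mI hg; apply: (measurability _ (RGenOInfty.measurableE R)) => //.
move=> _ [_ [y ->] <-]; rewrite preimage_itvoy.
exact: is_interval_measurable.
Qed.

Lemma graph_null (phi : R -> R) : measurable_fun setT phi ->
  let G := [set z : R * R | z.2 = phi z.1] in
  measurable G /\ (mu \x mu)%E G = 0%E.
Proof.
move=> mphi G; have mG : measurable G.
  have mb : measurable_fun setT (fun z : R * R => z.2 == phi z.1).
    by apply: measurable_fun_eqr => //; exact: measurableT_comp.
  have := mb measurableT [set true] I.
  rewrite setTI; congr measurable; apply/seteqP; split => z /=; first by move/eqP.
  by move=> ->; rewrite eqxx.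
split=> //; rewrite /product_measure1 integral0_eq// => x _ /=.
rewrite (_ : xsection G x = [set phi x]) ?lebesgue_measure_set1//.
by apply/seteqP; split => y; rewrite /xsection /= inE.
Qed.

Lemma vertical_null (x : R) : (mu \x mu)%E ([set x] `*` [set: R]) = 0%E.
Proof. by rewrite [LHS]product_measure1E// [X in (X * _)%E]lebesgue_measure_set1 mul0e. Qed.

End interval_length.

Section convex_region.
Context {R : realType}.
Notation mu := (@lebesgue_measure R).
Notation mu2 := (mu \x mu)%E.

Definition slice (D : set (R * R)) (p : R) : set R := [set q | D (p, q)].

Definition left_end (D : set (R * R)) : R := inf (fst @` D).

Definition right_end (D : set (R * R)) : R := sup (fst @` D).

(** The value is 0 at the two ends as well, where the body may have a whole edge or no point at all.
    Strictly between them every slice of a convex set is nonempty and [sup] and [inf] are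
    meaningful. *)
Definition profile (D : set (R * R)) (p : R) : R :=
  if left_end D < p < right_end D then sup (slice D p) - inf (slice D p) else 0.

Variables (D : set (R * R)) (M : R).
Hypothesis convD : forall x y t, D x -> D y -> 0 <= t -> t <= 1 ->
  D (t * x.1 + (1 - t) * y.1, t * x.2 + (1 - t) * y.2).
Hypothesis boundD : forall z, D z -> `|z.1| <= M /\ `|z.2| <= M.
Hypothesis neD : D !=set0.

Let a := left_end D.
Let b := right_end D.

Lemma conv3D x y p : D x -> D y -> x.1 < p -> p < y.1 ->
  D (p, ((y.1 - p) * x.2 + (p - x.1) * y.2) / (y.1 - x.1)).
Proof.
move=> Dx Dy xp py; have d0 : 0 < y.1 - x.1 by lra.
have := @convD x y ((y.1 - p) / (y.1 - x.1)) Dx Dy.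
rewrite ler_pdivrMr// ler_pdivlMr// mul0r mul1r => H.
have {}H := H ltac:(lra) ltac:(lra); move: H; congr D; congr pair.
  by field; lra.
by field; lra.
Qed.

Lemma projD_bounded : has_lbound (fst @` D) /\ has_ubound (fst @` D).
Proof.
split; [exists (- M)|exists M] => _ [z Dz <-]; have [+ _] := boundD Dz;
  by rewrite ler_norml => /andP[].
Qed.

Lemma projD_range z : D z -> a <= z.1 <= b.
Proof.
move=> Dz; have [l u] := projD_bounded; apply/andP; split.
  by apply: ge_inf => //; exists z.
by apply: ub_le_sup => //; exists z.
Qed.

Lemma slice_nonempty p : a < p < b -> slice D p !=set0.
Proof.
move=> /andP[ap pb]; have ne : (fst @` D) !=set0.
  by case: neD => z Dz; exists z.1; exists z.
have [_ [x Dx <-] xp] := inf_lt ne ap.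
have [_ [y Dy <-] py] := sup_gt ne pb.
by eexists; exact: conv3D Dx Dy xp py.
Qed.

Lemma slice_interval p : is_interval (slice D p).
Proof.
move=> x y Dx Dy z /andP[].
rewrite le_eqVlt => /predU1P[<- //|xz]; rewrite le_eqVlt => /predU1P[-> //|zy].
have d0 : 0 < y - x by lra.
have := @convD (p, x) (p, y) ((y - z) / (y - x)) Dx Dy.
rewrite ler_pdivrMr// ler_pdivlMr// mul0r mul1r => H.
have {}H := H ltac:(lra) ltac:(lra); move: H; rewrite /slice /=; congr D; congr pair.
  by ring.
by field; lra.
Qed.

Lemma slice_bounded p : has_lbound (slice D p) /\ has_ubound (slice D p).
Proof.
split; [exists (- M)|exists M] => q Dq; have [_ +] := boundD Dq;
  by rewrite ler_norml => /andP[].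
Qed.

Lemma slice_mem p q : slice D p q -> inf (slice D p) <= q <= sup (slice D p).
Proof.
move=> Dq; have [l u] := slice_bounded p.
by apply/andP; split; [exact: ge_inf|exact: ub_le_sup].
Qed.

Lemma slice_open p q : a < p < b -> inf (slice D p) < q < sup (slice D p) -> D (p, q).
Proof.
move=> ab /andP[q1 q2]; have ne := slice_nonempty ab.
have [x Dx xq] := inf_lt ne q1; have [y Dy qy] := sup_gt ne q2.
by apply: (slice_interval Dx Dy); rewrite !ltW.
Qed.

Lemma slice_measure p : a < p < b -> mu (slice D p) = (profile D p)%:E.
Proof.
move=> ab; rewrite lebesgue_measure_interval ?/profile ?ab//.
- exact: slice_interval.
- exact: slice_nonempty.
- by have [] := slice_bounded p.
- by have [] := slice_bounded p.
Qed.

Lemma inf_le_sup_slice p : a < p < b -> inf (slice D p) <= sup (slice D p).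
Proof.
by move=> /slice_nonempty[q Dq]; have /andP[] := slice_mem Dq; exact: le_trans.
Qed.

Lemma profile_ge0 p : 0 <= profile D p.
Proof. by rewrite /profile; case: ifPn => // ab; rewrite subr_ge0 inf_le_sup_slice. Qed.

Lemma profile_supp p : ~ (a < p < b) -> profile D p = 0.
Proof. by move=> /negP; rewrite /profile => /negbTE ->. Qed.

(** A segment joining the slices at [x] and [y] crosses the slice at [z]. The supremum is taken over
    one endpoint at a time, so neither needs to be attained. *)
Lemma sup_slice_concave x z y : a < x -> x < z -> z < y -> y < b ->
  (y - z) * sup (slice D x) + (z - x) * sup (slice D y) <= (y - x) * sup (slice D z).
Proof.
move=> ax xz zy yb.
have d0 : 0 < y - x by lra.
have [e1 e2] : 0 < y - z /\ 0 < z - x by lra.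
have nx : slice D x !=set0 by apply: slice_nonempty; apply/andP; split; rewrite -/a -/b; lra.
have ny : slice D y !=set0 by apply: slice_nonempty; apply/andP; split; rewrite -/a -/b; lra.
have step q : slice D x q ->
    (z - x) * sup (slice D y) <= (y - x) * sup (slice D z) - (y - z) * q.
  move=> Dq; rewrite mulrC -ler_pdivlMr//; apply: ge_sup => // r Dr.
  rewrite ler_pdivlMr// mulrC.
  have /slice_mem/andP[_] := conv3D Dq Dr xz zy.
  rewrite /= ler_pdivrMr//; move: (sup _) => S; lra.
have : sup (slice D x) <= ((y - x) * sup (slice D z) - (z - x) * sup (slice D y)) / (y - z).
  apply: ge_sup => // q Dq; rewrite ler_pdivlMr//.
  by have := step q Dq; move: (sup _) (sup _) => S T; lra.
by rewrite ler_pdivlMr//; move: (sup _) (sup _) (sup _) => S T U; lra.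
Qed.

End convex_region.

Section profile.
Context {R : realType}.
Notation mu := (@lebesgue_measure R).
Notation mu2 := (mu \x mu)%E.
Variables (D : set (R * R)) (M : R).
Hypothesis convD : forall x y t, D x -> D y -> 0 <= t -> t <= 1 ->
  D (t * x.1 + (1 - t) * y.1, t * x.2 + (1 - t) * y.2).
Hypothesis boundD : forall z, D z -> `|z.1| <= M /\ `|z.2| <= M.
Hypothesis neD : D !=set0.

Let a := left_end D.
Let b := right_end D.

(** Reflecting the second coordinate turns infima into opposite suprema. *)
Lemma inf_slice_convex x z y : a < x -> x < z -> z < y -> y < b ->
  (y - x) * inf (slice D z) <= (y - z) * inf (slice D x) + (z - x) * inf (slice D y).
Proof.
move=> ax xz zy yb; pose D' := [set w : R * R | D (w.1, - w.2)].
have projE : fst @` D' = fst @` D.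
  apply/seteqP; split => _ [w Dw <-]; first by exists (w.1, - w.2).
  by exists (w.1, - w.2) => //; rewrite /D' /= opprK -surjective_pairing.
have sliceE p : sup (slice D' p) = - inf (slice D p).
  rewrite /inf opprK; congr sup; apply/seteqP; split => q.
    by move=> Dq; exists (- q) => //; rewrite opprK.
  by move=> [r Dr <-]; rewrite /slice /D' /= opprK.
have := @sup_slice_concave R D' M _ _ _ x z y.
rewrite /left_end /right_end projE !sliceE => H.
suff : (y - z) * - inf (slice D x) + (z - x) * - inf (slice D y) <=
    (y - x) * - inf (slice D z).
  by move: (inf _) (inf _) (inf _) => p q r; lra.
apply: H => //.
- move=> u v t Du Dv t0 t1; have := convD Du Dv t0 t1.
  rewrite /D' /=; congr D; congr pair; ring.
- by move=> u /boundD; rewrite /= normrN.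
- by case: neD => w Dw; exists (w.1, - w.2); rewrite /D' /= opprK -surjective_pairing.
Qed.

Lemma profile_concave : concave_itv (profile D) a b.
Proof.
move=> x z y ax xz zy yb; rewrite /profile -/a -/b.
rewrite !ifT; [|by apply/andP; split; lra..].
have := sup_slice_concave convD boundD neD ax xz zy yb.
have := inf_slice_convex ax xz zy yb.
move: (inf (slice D z)) (inf (slice D x)) (inf (slice D y)) => p q r.
move: (sup (slice D z)) (sup (slice D x)) (sup (slice D y)) => p' q' r' H1 H2.
have : (y - z) * (q' - q) + (z - x) * (r' - r) <= (y - x) * (p' - p) by lra.
by [].
Qed.

Definition upper_edge (p : R) : R := if a < p < b then sup (slice D p) else 0.

Definition lower_edge (p : R) : R := if a < p < b then inf (slice D p) else 0.

Lemma profileE p : profile D p = upper_edge p - lower_edge p.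
Proof. by rewrite /profile /upper_edge /lower_edge -/a -/b; case: ifP; rewrite ?subrr. Qed.

Lemma measurable_if_itv (g : R -> R) : measurable_fun `]a, b[ g ->
  measurable_fun setT (fun p => if a < p < b then g p else 0).
Proof.
move=> mg; have := (measurable_restrictT g (measurable_itv `]a, b[)).1 mg.
congr (measurable_fun _ _); apply/funext => p.
by rewrite patchE mem_setE in_itv.
Qed.

Lemma measurable_upper_edge : measurable_fun setT upper_edge.
Proof.
apply: measurable_if_itv; apply: measurable_fun_superlevel_interval => // y.
move=> u v [/=]; rewrite !in_itv/= => /andP[au ub] yu [/andP[av vb] yv] w /andP[].
rewrite le_eqVlt => /predU1P[<- _|uw]; first by rewrite in_itv/= au ub.
rewrite le_eqVlt => /predU1P[->|wv]; first by rewrite in_itv/= av vb.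
have H := sup_slice_concave convD boundD neD au uw wv vb.
rewrite in_itv/= (lt_trans au uw) (lt_trans wv vb); split=> //.
move: H yu yv.
move: (sup (slice D u)) (sup (slice D v)) (sup (slice D w)) => p q r H yu yv.
suff : (v - u) * y < (v - u) * r by rewrite ltr_pM2l//; lra.
have h1 : 0 < (v - w) * (p - y) by rewrite mulr_gt0//; lra.
have h2 : 0 < (w - u) * (q - y) by rewrite mulr_gt0//; lra.
lra.
Qed.

Lemma measurable_lower_edge : measurable_fun setT lower_edge.
Proof.
apply: measurable_if_itv.
(* The opposite of the infimum is concave, so its superlevel sets are intervals; the outer sign is
   dropped at the end. *)
have : measurable_fun `]a, b[ (fun p => - - inf (slice D p)).
  apply: measurable_funN; apply: measurable_fun_superlevel_interval => // y.
  move=> u v [/=]; rewrite !in_itv/= => /andP[au ub] yu [/andP[av vb] yv] w /andP[].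
  rewrite le_eqVlt => /predU1P[<- _|uw]; first by rewrite in_itv/= au ub.
  rewrite le_eqVlt => /predU1P[->|wv]; first by rewrite in_itv/= av vb.
  have H := inf_slice_convex au uw wv vb.
  rewrite in_itv/= (lt_trans au uw) (lt_trans wv vb); split=> //.
  move: H yu yv.
  move: (inf (slice D u)) (inf (slice D v)) (inf (slice D w)) => p q r H yu yv.
  suff : (v - u) * y < (v - u) * - r by rewrite ltr_pM2l//; lra.
  have h1 : 0 < (v - w) * (- p - y) by rewrite mulr_gt0//; lra.
  have h2 : 0 < (w - u) * (- q - y) by rewrite mulr_gt0//; lra.
  lra.
by congr measurable_fun; apply/funext => p; rewrite opprK.
Qed.

(* A convex set need not be Borel, but it lies between the Borel set [region] and
   its union with the null set [region_border]. *)
Definition region : set (R * R) :=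
  [set z | a < z.1 < b /\ lower_edge z.1 < z.2 < upper_edge z.1].

Definition region_border : set (R * R) :=
  ([set a] `*` setT) `|` ([set b] `*` setT) `|`
  [set z | z.2 = lower_edge z.1] `|` [set z | z.2 = upper_edge z.1].

Lemma region_sub : region `<=` D.
Proof.
move=> [p q] [/= ab]; rewrite /lower_edge /upper_edge ab => pq.
exact: (slice_open convD neD ab pq).
Qed.

Lemma sub_region : D `<=` region `|` region_border.
Proof.
move=> [p q] Dpq; have /andP[] := projD_range boundD Dpq; rewrite -/a -/b /=.
rewrite le_eqVlt => /predU1P[pa _|ap]; first by right; left; left; left.
rewrite le_eqVlt => /predU1P[pb|pb]; first by right; left; left; right.
have ab : a < p < b by rewrite ap.
have /andP[] := slice_mem boundD Dpq.
have bE : inf (slice D p) = lower_edge p by rewrite /lower_edge ab.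
have tE : sup (slice D p) = upper_edge p by rewrite /upper_edge ab.
rewrite bE tE le_eqVlt => /predU1P[<- _|bq]; first by right; left; right.
rewrite le_eqVlt => /predU1P[->|qt]; first by right; right.
by left; split=> //=; rewrite bq.
Qed.

Lemma measurable_region : measurable region.
Proof.
have mb : measurable_fun setT (fun z : R * R =>
    ((a < z.1) && (z.1 < b)) && ((lower_edge z.1 < z.2) && (z.2 < upper_edge z.1))).
  have mt := measurable_upper_edge; have mbt := measurable_lower_edge.
  apply: measurable_and; apply: measurable_and; apply: measurable_fun_ltr => //;
    exact: measurableT_comp.
have := mb measurableT [set true] I.
rewrite setTI; congr measurable; apply/seteqP; split => z /=.
  by move=> /andP[].
by move=> [-> ->].
Qed.

Lemma region_border_null : measurable region_border /\ mu2 region_border = 0%E.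
Proof.
have [mB B0] := graph_null measurable_lower_edge.
have [mT T0] := graph_null measurable_upper_edge.
have mv (x : R) : measurable ([set x] `*` [set: R]) by exact: measurableX.
have mu0 (A B : set (R * R)) : measurable A -> measurable B -> mu2 A = 0%E ->
    mu2 B = 0%E -> measurable (A `|` B) /\ mu2 (A `|` B) = 0%E.
  move=> mA mB' A0 B0'; split; first exact: measurableU.
  apply/eqP; rewrite eq_le measure_ge0 andbT.
  have := @measureU2 _ _ _ mu2 _ _ mA mB'.
  by rewrite [X in (X + _)%E]A0 [X in (_ + X)%E]B0' adde0.
have [m1 n1] := mu0 _ _ (mv a) (mv b) (vertical_null a) (vertical_null b).
have [m2 n2] := mu0 _ _ m1 mB n1 B0.
exact: mu0.
Qed.

Lemma finsupp_region : finsupp mu2 (\1_region : R * R -> R).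
Proof.
apply: finsupp_indic; first exact: measurable_region.
have box : region `<=` `[- M, M] `*` `[- M, M].
  move=> z /region_sub /boundD [z1 z2]; split; rewrite /= in_itv/=.
    by move: z1; rewrite ler_norml.
  by move: z2; rewrite ler_norml.
have mbox : measurable (`[- M, M] `*` `[- M, M] : set (R * R)) by exact: measurableX.
have fin : (mu `[(- M)%R, M%R] < +oo)%E.
  by rewrite lebesgue_measure_itv /=; case: ifP => // _; rewrite -EFinD ltry.
apply: le_lt_trans (le_measure mu2 _ _ box) _; rewrite ?inE//.
  exact: measurable_region.
by rewrite [ltLHS]product_measure1E// lte_mul_pinfty// ge0_fin_numE.
Qed.

Lemma finsupp_profile : finsupp mu (profile D).
Proof.
split.
  rewrite (_ : profile D = upper_edge \- lower_edge); last by apply/funext => p; rewrite profileE.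
  by apply: measurable_funB; [exact: measurable_upper_edge|exact: measurable_lower_edge].
exists (M + M), `]a, b[%classic; split => //.
- by rewrite [ltLHS]lebesgue_measure_itv /=; case: ifP => // _; rewrite -EFinD ltry.
- move=> p; rewrite ger0_norm; last exact: (profile_ge0 convD boundD neD).
  have [w Dw] := neD; have [Mw _] := boundD Dw.
  have M0 : 0 <= M by exact: le_trans Mw.
  rewrite /profile -/a -/b; case: ifPn => [ab|_]; last by rewrite addr_ge0.
  have ne := slice_nonempty convD neD ab.
  apply: lerD.
    apply: ge_sup => // q /boundD[_ /=].
    by rewrite ler_norml => /andP[].
  rewrite lerNl; apply: lb_le_inf => // q /boundD[_ /=].
  by rewrite ler_norml => /andP[].
- by move=> p; rewrite /= in_itv /= => pab; exact: profile_supp.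
Qed.

Lemma Rintegral_region (h : R -> R) : measurable_fun setT h ->
  (exists K, forall x, `|h x| <= K) ->
  \int[mu2]_z (\1_region z * h z.1) = \int[mu]_p (profile D p * h p).
Proof.
move=> mh [K hK].
have mh1 : measurable_fun setT (fun z : R * R => h z.1) by exact: measurableT_comp.
have hF : finsupp mu2 (fun z => \1_region z * h z.1).
  by apply: finsuppM => //; [exact: finsupp_region|exists K].
pose sl p : set R := if a < p < b then `]lower_edge p, upper_edge p[%classic else set0.
have slE p : (fun q => \1_region (p, q) : R) = \1_(sl p).
  apply/funext => q; rewrite !indicE /sl; congr ((_ : bool)%:R).
  apply/idP/idP.
    by rewrite inE => -[/= -> pq]; rewrite inE /= in_itv.
  case: ifP => [ab|_]; last by rewrite inE.
  by rewrite inE /= in_itv /= => pq; rewrite inE; split.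
have msl p : measurable (sl p) by rewrite /sl; case: ifP.
have fsl p : mu (sl p) = (profile D p)%:E.
  rewrite /sl profileE; case: ifPn => ab; last first.
    by rewrite measure0 /upper_edge /lower_edge (negbTE ab) subrr.
  rewrite lebesgue_measure_itv /= lte_fin; case: ifPn => [_|]; first by rewrite EFinB.
  (* An empty open section forces the supremum and infimum to coincide, so the profile is 0 too. *)
  rewrite -leNgt /upper_edge /lower_edge ab => H; congr EFin; apply/eqP.
  rewrite eq_sym subr_eq0 eq_le H /=.
  exact: (inf_le_sup_slice convD boundD neD ab).
have hsl p : finsupp mu (fun q => \1_region (p, q) : R).
  rewrite slE; apply: finsupp_indic; first exact: msl.
  by rewrite [ltLHS]fsl ltry.
have hx p : finsupp mu (fun q => \1_region (p, q) * h p).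
  have -> : (fun q => \1_region (p, q) * h p) = (fun q => h p * \1_region (p, q)).
    by apply/funext => q; rewrite mulrC.
  exact: finsuppZ.
rewrite -(Rintegral_prod1 hF hx).2; apply: eq_Rintegral => p _ /=.
transitivity (\int[mu]_q (h p * \1_region (p, q))).
  by apply: eq_Rintegral => q _; rewrite mulrC.
rewrite finsupp_RintegralZ// slE mulrC; congr (_ * _).
by rewrite Rintegral_indic; [rewrite [X in fine X]fsl|exact: msl].
Qed.

End profile.

(** * Convex bodies *)

Section rotated_body.
Context {R : realType}.
Notation mu := (@lebesgue_measure R).
Notation mu2 := (mu \x mu)%E.

(** The body in the orthonormal frame of [theta]: the first coordinate runs along [unit_vec theta],
    the second along the chords. *)
Definition rotated (theta : R) (C : set (R * R)) : set (R * R) :=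
  [set z | C (cos theta * z.1 - sin theta * z.2, sin theta * z.1 + cos theta * z.2)].

Lemma convex_set_conv (C : set (R * R)) x y t : convex_set C ->
  C x -> C y -> 0 <= t -> t <= 1 ->
  C (t * x.1 + (1 - t) * y.1, t * x.2 + (1 - t) * y.2).
Proof.
move=> cC Cx Cy t0 t1.
have := cC x y (Itv01 t0 t1); rewrite !inE; exact.
Qed.

Lemma rotated_range (x y c s e : R) : `|c| <= 1 -> `|s| <= 1 ->
  `|x| < e -> `|y| < e -> `|c * x + s * y| < 2 * e.
Proof.
move=> c1 s1 xe ye; apply: le_lt_trans (ler_normD _ _) _.
have -> : 2 * e = e + e by ring.
rewrite !normrM; apply: ltrD.
  by apply: le_lt_trans xe; rewrite ler_piMl.
by apply: le_lt_trans ye; rewrite ler_piMl.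
Qed.

(** [M] and [r] are chosen before [theta]: the uniform [r] is what bounds [shortest_diameter], an
    infimum over all angles, away from 0. *)
Lemma rotated_props (C : set (R * R)) : convex_body C ->
  exists M r : R, 0 < r /\ forall theta, [/\
    forall x y t, rotated theta C x -> rotated theta C y -> 0 <= t -> t <= 1 ->
      rotated theta C (t * x.1 + (1 - t) * y.1, t * x.2 + (1 - t) * y.2),
    forall z, rotated theta C z -> `|z.1| <= M /\ `|z.2| <= M
  & exists z0 : R * R, forall z, `|z.1 - z0.1| < r -> `|z.2 - z0.2| < r ->
      rotated theta C z].
Proof.
move=> [[M0 [_ HM0]] cC [c0 /nbhs_ballP[e /= e0 ce]]].
pose M1 := `|M0| + 1.
have CM z : C z -> `|z.1| < M1 + 1 /\ `|z.2| < M1 + 1.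
  move=> Cz; have : `|z| <= M1.
    by apply: HM0 => //; rewrite /M1 ltr_pwDr// ler_norm.
  rewrite prod_normE ge_max => /andP[z1 z2]; split.
    by rewrite (le_lt_trans z1)// ltrDl.
  by rewrite (le_lt_trans z2)// ltrDl.
(* A rotation at most doubles the largest coordinate, hence the factor 2 on the bound and 1/2 on the
   radius. *)
exists (2 * (M1 + 1)), (e / 2); split; first by rewrite divr_gt0.
move=> theta; have cs := cos2Dsin2 theta.
have [cle sle] := (normr_cos_le1 theta, normr_sin_le1 theta).
have sle' : `|- sin theta| <= 1 by rewrite normrN.
split.
- move=> x y t Dx Dy t0 t1; have := convex_set_conv cC Dx Dy t0 t1.
  by rewrite /rotated /=; congr C; congr pair; ring.
- move=> z /CM /= [z1 z2]; split; rewrite ltW//.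
    have -> : z.1 = cos theta * (cos theta * z.1 - sin theta * z.2) +
      sin theta * (sin theta * z.1 + cos theta * z.2).
      rewrite -[LHS]mul1r -cs; ring.
    exact: rotated_range.
  have -> : z.2 = - sin theta * (cos theta * z.1 - sin theta * z.2) +
      cos theta * (sin theta * z.1 + cos theta * z.2).
    rewrite -[LHS]mul1r -cs; ring.
  exact: rotated_range.
- exists (cos theta * c0.1 + sin theta * c0.2, - sin theta * c0.1 + cos theta * c0.2).
  move=> z /= z1 z2; apply: ce; split => /=; rewrite -ball_normE /ball_ /= distrC.
    rewrite (_ : _ - c0.1 =
        cos theta * (z.1 - (cos theta * c0.1 + sin theta * c0.2)) +
        - sin theta * (z.2 - (- sin theta * c0.1 + cos theta * c0.2))); last first.
      by rewrite -[c0.1 in LHS]mul1r -cs; ring.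
    by have := rotated_range cle sle' z1 z2; rewrite mulrCA divff// mulr1.
  rewrite (_ : _ - c0.2 =
      sin theta * (z.1 - (cos theta * c0.1 + sin theta * c0.2)) +
      cos theta * (z.2 - (- sin theta * c0.1 + cos theta * c0.2))); last first.
    by rewrite -[c0.2 in LHS]mul1r -cs; ring.
  by have := rotated_range sle cle z1 z2; rewrite mulrCA divff// mulr1.
Qed.

Lemma dot_unit_vec (x : R * R) theta :
  dot x (unit_vec theta) = cos theta * x.1 + sin theta * x.2.
Proof. by rewrite /dot /= ![_ * x.1]mulrC ![_ * x.2]mulrC. Qed.

Lemma dot_unit_vec_perp (x : R * R) theta :
  dot x (unit_vec (theta + pi / 2)) = - sin theta * x.1 + cos theta * x.2.
Proof. by rewrite dot_unit_vec cosDpihalf sinDpihalf. Qed.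

Lemma rotated_mem theta (C : set (R * R)) x :
  rotated theta C (dot x (unit_vec theta), dot x (unit_vec (theta + pi / 2))) <-> C x.
Proof.
rewrite /rotated dot_unit_vec_perp dot_unit_vec /=.
have cs := cos2Dsin2 theta.
rewrite [X in C X](_ : _ = x)//; rewrite [RHS]surjective_pairing; congr pair.
  by rewrite -[RHS]mul1r -cs; ring.
by rewrite -[RHS]mul1r -cs; ring.
Qed.

Lemma unrotate theta (z : R * R) :
  let x := (cos theta * z.1 - sin theta * z.2, sin theta * z.1 + cos theta * z.2) in
  dot x (unit_vec theta) = z.1 /\ dot x (unit_vec (theta + pi / 2)) = z.2.
Proof.
rewrite /= dot_unit_vec_perp dot_unit_vec /=; have cs := cos2Dsin2 theta.
by split; rewrite -[RHS]mul1r -cs; ring.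
Qed.

Lemma proj_rotated theta (C : set (R * R)) :
  [set dot y (unit_vec theta) | y in C] = fst @` rotated theta C.
Proof.
apply/seteqP; split => _ [z Cz <-].
  by exists (dot z (unit_vec theta), dot z (unit_vec (theta + pi / 2))) => //;
    exact/rotated_mem.
by eexists; [exact: Cz|rewrite (unrotate theta z).1].
Qed.

Lemma chord_slice theta lambda (C : set (R * R)) :
  [set dot x (unit_vec (theta + pi / 2)) | x in chord C theta lambda] =
  slice (rotated theta C) (left_end (rotated theta C) + lambda).
Proof.
rewrite /chord (proj_rotated theta C) -/(left_end _); apply/seteqP; split.
  by move=> _ [x [Cx xl] <-]; rewrite /slice /= -xl; exact/rotated_mem.
move=> q; rewrite /slice /=; set p := _ + lambda => Dpq.
have [h1 h2] := unrotate theta (p, q).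
by eexists; [split; [exact: Dpq|exact: h1]|exact: h2].
Qed.

Lemma rotatedDpi theta (C : set (R * R)) z :
  rotated (theta + pi) C z = rotated theta C (- z.1, - z.2).
Proof. by rewrite /rotated /= cosDpi sinDpi; congr C; congr pair; ring. Qed.

(** A half-turn exchanges the ends, so the chord at angle [theta + pi] is measured from the right
    end. *)
Lemma left_end_rotatedDpi theta (C : set (R * R)) :
  left_end (rotated (theta + pi) C) = - right_end (rotated theta C).
Proof.
rewrite /left_end /right_end /inf; congr (- sup _); apply/seteqP; split => p.
  move=> [_ [z Dz <-] <-]; exists (- z.1, - z.2) => //.
  by rewrite -rotatedDpi.
move=> [z Dz <-]; exists (- z.1); last by rewrite opprK.
by exists (- z.1, - z.2) => //; rewrite rotatedDpi /= !opprK -surjective_pairing.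
Qed.

Lemma slice_rotatedDpi theta (C : set (R * R)) p :
  slice (rotated (theta + pi) C) p = (fun q => -1 * q + 0) @^-1` slice (rotated theta C) (- p).
Proof.
by apply/seteqP; split => q; rewrite /slice /= rotatedDpi /= mulN1r addr0.
Qed.

End rotated_body.

(** * Chords and directional diameters *)

Section body.
Context {R : realType}.
Notation mu := (@lebesgue_measure R).
Notation mu2 := (mu \x mu)%E.

Lemma rotatedDpihalf theta (C : set (R * R)) z :
  rotated (theta + pi / 2) C z = rotated theta C (- z.2, z.1).
Proof. by rewrite /rotated /= cosDpihalf sinDpihalf; congr C; congr pair; ring. Qed.

Lemma chord_lengthE (C : set (R * R)) theta lambda : chord_length C theta lambda =
  fine (mu (slice (rotated theta C) (left_end (rotated theta C) + lambda))).
Proof. by rewrite /chord_length chord_slice. Qed.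

Lemma chord_length_ge0 (C : set (R * R)) theta lambda : 0 <= chord_length C theta lambda.
Proof. by rewrite chord_lengthE fine_ge0. Qed.

Lemma fine_measure_interval_le (E : set R) (x y : R) : is_interval E -> x <= y ->
  E `<=` `[x, y] -> fine (mu E) <= y - x.
Proof.
move=> /is_interval_measurable mE xy Exy.
have muxy : mu `[x, y] = (y - x)%:E.
  rewrite lebesgue_measure_itv /= lte_fin; case: ltgtP xy => // <-.
  by rewrite subrr.
have h : (mu E <= (y - x)%:E)%E by rewrite -[leRHS]muxy; apply: le_measure; rewrite ?inE.
by rewrite -lee_fin fineK// ge0_fin_numE// (le_lt_trans h)// ltry.
Qed.

(** Cauchy-Schwarz through Lagrange's identity: the defect is the square of the component orthogonal
    to [unit_vec theta]. *)
Lemma dot_unit_vecB_le (x y : R * R) theta :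
  dot x (unit_vec theta) - dot y (unit_vec theta) <= eucl_norm (x - y).
Proof.
have cs := cos2Dsin2 theta.
apply: le_trans (ler_norm _) _; rewrite -sqrtr_sqr; apply: ler_wsqrtr.
rewrite !dot_unit_vec /dot /=; move: (cos theta) (sin theta) cs => c s cs.
have := sqr_ge0 (c * (x.2 - y.2) - s * (x.1 - y.1)) => h.
rewrite -subr_ge0; apply: le_trans h _.
rewrite le_eqVlt; apply/orP; left; apply/eqP.
transitivity ((c ^+ 2 + s ^+ 2) * ((x.1 - y.1) ^+ 2 + (x.2 - y.2) ^+ 2) -
  (c * x.1 + s * x.2 - (c * y.1 + s * y.2)) ^+ 2); first by ring.
by rewrite cs; ring.
Qed.

Variable C : set (R * R).
Hypothesis hC : convex_body C.

Lemma rotated_nonempty theta : rotated theta C !=set0.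
Proof.
have [M [r [r0 H]]] := rotated_props hC; have [_ _ [z0 Hz]] := H theta.
by exists z0; apply: Hz; rewrite subrr normr0.
Qed.

Lemma chord_length_bounded theta :
  has_ubound [set chord_length C theta lambda | lambda in `[0, +oo[].
Proof.
have [M [r [r0 H]]] := rotated_props hC; have [h1 h2 _] := H theta.
have [z Dz] := rotated_nonempty theta.
have M0 : 0 <= M by have [+ _] := h2 z Dz; exact: le_trans.
exists (M - - M) => _ [lambda _ <-]; rewrite chord_lengthE.
apply: fine_measure_interval_le; first exact: slice_interval.
  by rewrite lerNl (le_trans _ M0)// oppr_le0.
by move=> q /h2 [_ /=]; rewrite in_itv /= ler_norml.
Qed.

(** The infimum is tested at [theta + pi / 2]: the chords for that angle run along [unit_vec theta],
    so none exceeds the width in that direction. *)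
Lemma shortest_diameter_le theta :
  shortest_diameter C <= right_end (rotated theta C) - left_end (rotated theta C).
Proof.
have [M [r [r0 H]]] := rotated_props hC; have [_ h2 _] := H theta.
have [h1 _ _] := H (theta + pi / 2).
apply: (@le_trans _ _ (sup [set chord_length C (theta + pi / 2) lambda | lambda in `[0, +oo[])).
  apply: ge_inf; last by exists (theta + pi / 2).
  (* The lower bound 0 makes this [inf] a genuine infimum rather than a default value. *)
  exists 0 => _ [t _ <-]; apply: (@le_trans _ _ (chord_length C t 0)).
    exact: chord_length_ge0.
  apply: ub_le_sup; first exact: chord_length_bounded.
  by exists 0 => //=; rewrite in_itv /= lexx.
apply: ge_sup => [|_ [lambda _ <-]].
  by exists (chord_length C (theta + pi / 2) 0), 0 => //=; rewrite in_itv /= lexx.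
rewrite chord_lengthE.
set a := left_end (rotated theta C); set b := right_end (rotated theta C).
rewrite (_ : b - a = - a - - b); last by ring.
apply: fine_measure_interval_le; first exact: slice_interval.
  have [z Dz] := rotated_nonempty theta.
  by have /andP[h3 h4] := projD_range h2 Dz; rewrite lerN2 (le_trans h3 h4).
move=> q; rewrite /slice /= rotatedDpihalf => /(projD_range h2) /=.
by rewrite in_itv /= -/a -/b => /andP[h3 h4]; rewrite lerNl h4 lerNr h3.
Qed.

(** At every angle, the chord through the centre [z0] of the inscribed square of half-side [r] has
    length at least [2 * r]. *)
Lemma shortest_diameter_gt0 : 0 < shortest_diameter C.
Proof.
have [M [r [r0 H]]] := rotated_props hC.
apply: (lt_le_trans r0); apply: lb_le_inf.
  by exists (sup [set chord_length C 0 lambda | lambda in `[0, +oo[]), 0.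
move=> _ [theta _ <-]; have [h1 h2 [z0 Hz]] := H theta.
apply: (@le_trans _ _ (chord_length C theta (z0.1 - left_end (rotated theta C)))); last first.
  apply: ub_le_sup; first exact: chord_length_bounded.
  eexists; last reflexivity; rewrite /= in_itv /= andbT subr_ge0.
  have Dz0 : rotated theta C z0 by apply: Hz; rewrite subrr normr0.
  by have /andP[] := projD_range h2 Dz0.
rewrite chord_lengthE addrC subrK.
set E := slice _ _; have iE : is_interval E by exact: slice_interval.
have mE : measurable E by exact: is_interval_measurable.
have finE : (mu E < +oo)%E.
  rewrite lebesgue_measure_interval// ?ltry//.
  - by exists z0.2; apply: Hz; rewrite subrr normr0.
  - by have [] := slice_bounded h2 z0.1.
  - by have [] := slice_bounded h2 z0.1.
rewrite -lee_fin fineK ?ge0_fin_numE//.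
have sub : `]z0.2 - r, z0.2 + r[ `<=` E.
  move=> q /=; rewrite in_itv /= => /andP[q1 q2]; apply: Hz => /=.
    by rewrite subrr normr0.
  by rewrite ltr_norml; apply/andP; split; lra.
apply: le_trans (le_measure mu _ _ sub); rewrite ?inE//.
rewrite [leRHS]lebesgue_measure_itv /= lte_fin ifT; last by lra.
by rewrite -EFinD lee_fin; lra.
Qed.

Lemma width_le_longest_diameter theta :
  right_end (rotated theta C) - left_end (rotated theta C) <= longest_diameter C.
Proof.
have [M [r [r0 H]]] := rotated_props hC; have [_ h2 _] := H 0.
have bC z : C z -> `|z.1| <= M /\ `|z.2| <= M.
  move=> Cz; apply: h2; rewrite /rotated /= cos0 sin0 !mul1r !mul0r subr0 add0r.
  by rewrite -surjective_pairing.
have ub : has_ubound [set eucl_norm (x - y) | x in C & y in C].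
  (* Each coordinate difference is at most [2 * M], which gives [4 * M ^ 2] twice. *)
  exists (Num.sqrt (8 * M ^+ 2)) => _ [x Cx [y Cy <-]].
  rewrite /eucl_norm; apply: ler_wsqrtr; rewrite /dot /=.
  have [x1 x2] := bC x Cx; have [y1 y2] := bC y Cy.
  have sq (u v : R) : `|u| <= M -> `|v| <= M -> (u - v) * (u - v) <= 4 * M ^+ 2.
    move=> uM vM; rewrite -expr2 -real_normK ?num_real//.
    have -> : 4 * M ^+ 2 = (M + M) ^+ 2 by ring.
    rewrite lerXn2r// ?nnegrE//; last exact: le_trans (ler_normB _ _) (lerD uM vM).
    by rewrite addr_ge0// (le_trans _ uM).
  by have := sq _ _ x1 y1; have := sq _ _ x2 y2; lra.
rewrite lerBlDr; apply: ge_sup.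
  by have [z Dz] := rotated_nonempty theta; exists z.1, z.
move=> _ [z Dz <-]; rewrite -lerBlDl; apply: lb_le_inf.
  by have [w Dw] := rotated_nonempty theta; exists w.1, w.
move=> _ [w Dw <-]; rewrite lerBlDr -lerBlDl.
have [ez _] := unrotate theta z; have [ew _] := unrotate theta w.
rewrite /rotated /= in Dz Dw; move: Dz Dw ez ew.
set x := (X in C X -> _); set y := (X in _ -> C X -> _) => Cx Cy <- <-.
apply: (@le_trans _ _ (eucl_norm (x - y))); last by apply: ub_le_sup => //; exists x => //; exists y.
exact: dot_unit_vecB_le.
Qed.

End body.

(** * The transform of a dilated convex body *)

Section fourier_body.
Context {R : realType}.
Notation mu := (@lebesgue_measure R).
Notation mu2 := (mu \x mu)%E.
Variable C : set (R * R).
Hypothesis hC : convex_body C.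

(** [N] divides by [delta] and passes to the frame of [theta], which takes the dilate onto the
    rotated body with Jacobian [delta ^ -2]. The Borel set [region] is pulled back through it, so
    the dilate need not be Borel. *)
Lemma Rintegral_dilate (delta theta : R) (h : R -> R) : 0 < delta ->
  measurable_fun setT h -> (exists K, forall x, `|h x| <= K) ->
  \int[mu2]_(x in dilate delta C) h (dot x (unit_vec theta) / delta) =
  delta ^+ 2 * \int[mu]_p (profile (rotated theta C) p * h p).
Proof.
move=> d0 mh hK; have [M [r [r0 H]]] := rotated_props hC.
have [h1 h2 _] := H theta; have h3 := rotated_nonempty hC theta.
set D := rotated theta C in h1 h2 h3 *.
pose al := cos theta / delta; pose be := sin theta / delta.
have dE : al ^+ 2 + be ^+ 2 = (delta ^+ 2)^-1.
  by rewrite /al /be !expr_div_n -mulrDl cos2Dsin2 mul1r.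
have dn0 : al ^+ 2 + be ^+ 2 != 0 by rewrite dE invr_eq0 expf_neq0// gt_eqF.
have := scales_similarity dn0; rewrite dE invrK.
set N := (fun z : R * R => _) => sN.
have NE x : (N x).1 = dot x (unit_vec theta) / delta.
  by rewrite /N /= dot_unit_vec /al /be; ring.
have dilD x : dilate delta C x <-> D (N x).
  have E : (cos theta * (N x).1 - sin theta * (N x).2,
            sin theta * (N x).1 + cos theta * (N x).2) = delta^-1 *: x.
    rewrite /N /al /be [RHS]surjective_pairing /=.
    congr pair; rewrite -[RHS]mulr1 -(cos2Dsin2 theta) /GRing.scale /=; ring.
  rewrite /D /rotated /= E; split.
    by move=> [y Cy <-]; rewrite scalerA mulVf ?scale1r// gt_eqF.
  by move=> Cx; eexists; [exact: Cx|rewrite scalerA divff ?scale1r// gt_eqF].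
have mU := measurable_region h1 h2 h3.
have [mZ Z0] := region_border_null h1 h2 h3.
have [mN sNA] := sN.
rewrite (@Rintegral_mod_null _ _ _ mu2 (N @^-1` region D) _ (N @^-1` region_border D)); first last.
- have : measurable_fun setT (h \o fst \o N).
    apply: measurableT_comp => //; exact: measurableT_comp.
  by congr measurable_fun; apply/funext => x; rewrite -NE.
- by move=> x /dilD /(sub_region h2).
- by move=> x /(region_sub h1 h3) /dilD.
- by rewrite [LHS]sNA// [X in (_ * X)%E]Z0 mule0.
- exact: measurable_preimage.
- exact: measurable_preimage.
rewrite Rintegral_mkcond.
rewrite -(Rintegral_region h1 h2 h3 mh hK) -(Rintegral_scales _ sN) ?sqr_ge0//; last first.
  apply: finsuppM; first exact: (finsupp_region h1 h2 h3).
    exact: measurableT_comp.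
  by case: hK => K hK; exists K.
apply: eq_Rintegral => x _; rewrite patchE indicE NE.
rewrite (_ : (x \in N @^-1` region D) = (N x \in region D)); last first.
  by apply/idP/idP; rewrite !inE.
by case: ifPn; rewrite ?mul1r ?mul0r.
Qed.

Lemma normc_fourier_dilate (delta theta rho : R) : 0 <= delta ->
  ComplexField.Normc.normc
    (fourier_indicator (dilate delta C) (rho *: unit_vec theta)) ^+ 2 =
  delta ^+ 4 *
    (cos_transform (profile (rotated theta C)) (2 * pi * rho * delta) ^+ 2 +
     sin_transform (profile (rotated theta C)) (2 * pi * rho * delta) ^+ 2).
Proof.
have [M [r [r0 H]]] := rotated_props hC; have [h1 h2 _] := H theta.
have h3 := rotated_nonempty hC theta.
have hf := finsupp_profile h1 h2 h3.
have dotZ x : dot x (rho *: unit_vec theta) = rho * dot x (unit_vec theta).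
  by rewrite /dot /= /GRing.scale /=; ring.
(* At [delta = 0] the dilate lies in a single point, and both sides are 0. *)
rewrite le_eqVlt => /predU1P[<-|d0].
  rewrite expr0n /= mul0r /fourier_indicator /integral2C.
  have Z x : dilate 0 C x -> ([set 0] `*` [set 0]) x.
    by move=> [y _ <-]; rewrite scale0r.
  have mZ : measurable ([set 0] `*` [set 0] : set (R * R)) by exact: measurableX.
  have Z0 : mu2 ([set 0] `*` [set 0]) = 0%E.
    by rewrite [LHS]product_measure1E// [X in (X * _)%E]lebesgue_measure_set1 mul0e.
  have int0 (g : R * R -> R) : measurable_fun setT g ->
      \int[mu2]_(x in dilate 0 C) g x = 0.
    move=> mg; rewrite (@Rintegral_mod_null _ _ _ mu2 set0 _ _ _ measurable0 mZ Z0)//.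
      by rewrite Rintegral_set0.
    by move=> x /Z; right.
  have mdot : measurable_fun setT (fun x : R * R =>
      - (2 * pi * dot x (rho *: unit_vec theta))).
    apply: measurable_funN; apply: measurable_funM => //.
    by apply: measurable_funD; apply: measurable_funM.
  rewrite int0; last first.
    by apply: measurableT_comp mdot; apply: continuous_measurable_fun; exact: continuous_cos.
  rewrite int0; last first.
    by apply: measurableT_comp mdot; apply: continuous_measurable_fun; exact: continuous_sin.
  by rewrite /= expr0n /= addr0 sqrtr0 expr0n.
have dn : delta != 0 by rewrite gt_eqF.
set f := profile _ in hf *; set t := 2 * pi * rho * delta.
have reE : \int[mu2]_(x in dilate delta C)
    cos (- (2 * pi * dot x (rho *: unit_vec theta))) = delta ^+ 2 * cos_transform f t.
  rewrite -(@Rintegral_dilate delta theta (fun p => cos (t * p)))//.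
  - apply: eq_Rintegral => x _; rewrite cosN dotZ /t; congr cos; field.
    exact: dn.
  - exact: measurable_cosM.
  - by exists 1 => x; exact: normr_cos_le1.
have imE : \int[mu2]_(x in dilate delta C)
    sin (- (2 * pi * dot x (rho *: unit_vec theta))) = - (delta ^+ 2 * sin_transform f t).
  rewrite -mulrN -sin_transformN// -(@Rintegral_dilate delta theta (fun p => sin (- t * p)))//.
  - apply: eq_Rintegral => x _; rewrite dotZ /t; congr sin; field.
    exact: dn.
  - exact: measurable_sinM.
  - by exists 1 => x; exact: normr_sin_le1.
rewrite /fourier_indicator /integral2C /= reE imE sqr_sqrtr ?addr_ge0 ?sqr_ge0//.
by ring.
Qed.

Lemma integral_normc_fourier (theta rho : R) :
  (\int[mu]_(delta in `[0%R, 1%R])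
    (ComplexField.Normc.normc
      (fourier_indicator (dilate delta C) (rho *: unit_vec theta)) ^+ 2)%:E)%E =
  (\int[mu]_d weighted_power (profile (rotated theta C)) (2 * pi * rho) d)%:E.
Proof.
have [M [r [r0 H]]] := rotated_props hC; have [h1 h2 _] := H theta.
have hf := finsupp_profile h1 h2 (rotated_nonempty hC theta).
rewrite /Rintegral fineK; last first.
  by apply: integrable_fin_num => //; apply: finsupp_integrable; exact: finsupp_weighted_power.
rewrite [LHS]integral_mkcond; apply: eq_integral => d _.
rewrite patchE /weighted_power indicE mem_setE; case: ifPn => [|_]; last by rewrite mul0r.
by rewrite in_itv /= => /andP[d0 _]; rewrite normc_fourier_dilate// mul1r.
Qed.

Lemma max_chord_lengthE (theta s : R) : 0 < s ->
  s < right_end (rotated theta C) - left_end (rotated theta C) ->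
  max_chord_length C theta s =
  Num.max (profile (rotated theta C) (left_end (rotated theta C) + s))
          (profile (rotated theta C) (right_end (rotated theta C) - s)).
Proof.
have [M [r [r0 H]]] := rotated_props hC; have [h1 h2 _] := H theta.
have h3 := rotated_nonempty hC theta; set D := rotated theta C in h1 h2 h3 *.
set a := left_end D; set b := right_end D.
move=> s0 sab; rewrite /max_chord_length !chord_lengthE; congr Num.max.
  by rewrite (slice_measure h1 h2 h3)// -/a -/b; apply/andP; split; lra.
rewrite slice_rotatedDpi left_end_rotatedDpi -/D -/b opprD opprK.
rewrite lebesgue_measure_affine ?oppr_eq0 ?oner_eq0//; last first.
  by apply: is_interval_measurable; exact: slice_interval.
rewrite normrN1 invr1 mul1e (slice_measure h1 h2 h3)//.
by rewrite -/a -/b; apply/andP; split; lra.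
Qed.

Lemma width_ge (theta rho : R) :
  11 * longest_diameter C ^+ 6 / shortest_diameter C ^+ 7 <= rho ->
  0 < rho /\ 11 * rho^-1 <= right_end (rotated theta C) - left_end (rotated theta C).
Proof.
have S0 := shortest_diameter_gt0 hC; have SW := shortest_diameter_le hC theta.
have WL := width_le_longest_diameter hC theta.
set S := shortest_diameter C in S0 SW *; set L := longest_diameter C in WL *.
set W := right_end _ - left_end _ in SW WL * => h.
(* Since [S <= L], the quotient [L ^ 6 / S ^ 7] is at least [1 / S]. *)
have hS : 11 / S <= rho.
  apply: le_trans h; rewrite (exprSr S 6) -mulrA ler_pM2l//.
  rewrite invfM mulrA -[leLHS]mul1r ler_pM2r ?invr_gt0//.
  rewrite ler_pdivlMr ?exprn_gt0// mul1r lerXn2r// ?nnegrE ?(ltW S0)//.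
    by rewrite (le_trans (ltW S0))// (le_trans SW).
  exact: le_trans SW WL.
have rho0 : 0 < rho by rewrite (lt_le_trans _ hS)// divr_gt0.
split=> //; apply: le_trans SW.
by rewrite ler_pdivrMr// mulrC -ler_pdivrMr.
Qed.

End fourier_body.

Theorem lemma3p3 (R : realType) :
  exists kappa3 kappa4 : R, 0 < kappa3 /\ 0 < kappa4 /\
  forall (C : set (R * R)) (theta rho : R),
    convex_body C ->
    kappa3 * longest_diameter C ^+ 6 / shortest_diameter C ^+ 7 <= rho ->
    let I := (\int[@lebesgue_measure R]_(delta in `[0%R, 1%R])
      (ComplexField.Normc.normc
        (fourier_indicator (dilate delta C) (rho *: unit_vec theta)) ^+ 2)%:E)%E in
    ((kappa4 * rho ^- 2 * max_chord_length C theta rho^-1 ^+ 2)%:E <= I)%E /\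
    (I <= (2 * rho ^- 2 * max_chord_length C theta rho^-1 ^+ 2)%:E)%E.
Proof.
have [c c0 hc] := @weight_transform_gt0 R 24 ltac:(by []).
(* With [s = 1 / rho], a width of [11 * s] leaves [a + 10 * s] strictly inside the interval. In the
   second constant, 8/9 comes from [concave_ge] and [c] bounds [weight_transform] below on
   [8, 24]. *)
exists 11, ((8 / 9 * c) ^+ 2); split=> //; split.
  by rewrite exprn_gt0// mulr_gt0.
move=> C theta rho hC /(width_ge hC theta)[rho0 hw] I.
have [M [r [r0 H]]] := rotated_props hC; have [h1 h2 _] := H theta.
have h3 := rotated_nonempty hC theta.
have hf := finsupp_profile h1 h2 h3.
have f0 := profile_ge0 h1 h2 h3.
have cf := profile_concave h1 h2 h3.
have supp := @profile_supp _ (rotated theta C).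
have s0 : 0 < rho^-1 by rewrite invr_gt0.
have tE : 2 * pi * rho = 2 * pi / rho^-1 by rewrite invrK.
rewrite /I integral_normc_fourier// tE !lee_fin -!exprVn max_chord_lengthE//; last first.
  by apply: lt_le_trans hw; rewrite ltr_pMl// ltr1n.
split.
  exact: (Rintegral_weighted_power_ge hf f0 cf supp s0 hw (ltW c0) hc).
exact: (Rintegral_weighted_power_le hf f0 cf supp s0 hw).
Qed.
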